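(* Let $n\ge2$, $1\le M\le n$, and let $\underline{s}\in\mathbb{R}^n$ with $s_i>\frac12$ for $i\neq M$ and $s_M>0$; put $s_0=s_{n+1}=0$. The inverse mean map $\psi^{(M)}_{\underline{s}}:Q_G\to P_G$ of the Wishart family $(\gamma^{(M)}_{\underline{s},y})_{y\in P_G}$ is given, for $m\in Q_G$, by $$\psi^{(M)}_{\underline{s}}(m)=\sum_{k=1}^{M-1}s_k\bigl((m_{\{k:k+1\}})^{-1}\bigr)^0+\sum_{k=M+1}^{n}s_k\bigl((m_{\{k-1:k\}})^{-1}\bigr)^0-\sum_{k=2}^{M-1}s_{k-1}\bigl((m_{kk})^{-1}\bigr)^0$$ $$\qquad-(s_{M-1}-s_M+s_{M+1})\bigl((m_{MM})^{-1}\bigr)^0-\sum_{k=M+1}^{n-1}s_{k+1}\bigl((m_{kk})^{-1}\bigr)^0.$$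
   Context: $G=A_n$ is the path graph $1-2-\cdots-n$ on $V=\{1,\dots,n\}$; $E=\{(i,j): |i-j|\le 1\}$. $Z_G$ is the space of real symmetric $n\times n$ matrices $y$ with $y_{ij}=0$ if $(i,j)\notin E$; $P_G$ is the set of positive definite $y\in Z_G$. $I_G$ is the dual space of $Z_G$, realised as the space of incomplete symmetric matrices $\eta=(\eta_{ij})_{(i,j)\in E}$, with $\langle y,\eta\rangle=\mathrm{tr}(y\eta)=\sum_{(i,j)\in E}y_{ij}\eta_{ij}$. $Q_G=\{\eta\in I_G:\langle y,\eta\rangle>0\ \forall y\in\overline{P_G}\setminus\{0\}\}$. $d\eta$ is Lebesgue measure on $I_G$. For $I\subset V$, $\eta_I$ is the submatrix with rows and columns in $I$; $\{i:j\}=\{i,\dots,j\}$; $|\cdot|$ is the determinant. For a matrix $K$ with rows and columns indexed by $B\subset V$, $K^0$ is the $n\times n$ matrix with $(K^0)_{ij}=K_{ij}$ if $i,j\in B$ and $0$ otherwise; $((m_{kk})^{-1})^0$ has the single nonzero entry $m_{kk}^{-1}$ at position $(k,k)$. For $\eta\in Q_G$ (with $s_0=s_{n+1}=0$), $$\delta^{(M)}_{\underline{s}}(\eta)=\frac{\prod_{i=1}^{M-1}|\eta_{\{i:i+1\}}|^{s_i}\prod_{i=M+1}^{n}|\eta_{\{i-1:i\}}|^{s_i}}{\prod_{i=2}^{M-1}\eta_{ii}^{s_{i-1}}\cdot\eta_{MM}^{s_{M-1}-s_M+s_{M+1}}\cdot\prod_{i=M+1}^{n-1}\eta_{ii}^{s_{i+1}}},\qquad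 \varphi_{A_n}(\eta)=\prod_{i=1}^{n-1}|\eta_{\{i,i+1\}}|^{-3/2}\prod_{i=2}^{n-1}\eta_{ii}.$$ For $y\in P_G$, $\gamma^{(M)}_{\underline{s},y}$ is the probability measure on $Q_G$ with density proportional to $e^{-\mathrm{tr}(y\eta)}\delta^{(M)}_{\underline{s}}(\eta)\varphi_{A_n}(\eta)$ with respect to $d\eta$. Its mean function is $m^{(M)}_{\underline{s}}(y)=\int_{Q_G}\eta\,\gamma^{(M)}_{\underline{s},y}(d\eta)$; $m^{(M)}_{\underline{s}}:P_G\to Q_G$ is a diffeomorphism and $\psi^{(M)}_{\underline{s}}:Q_G\to P_G$ is its inverse. *)

(* Defs.v *)
From HB Require Import structures.
From mathcomp Require Import all_boot all_order all_algebra.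
From mathcomp Require Import all_classical all_reals all_analysis.

Set Implicit Arguments.
Unset Strict Implicit.
Unset Printing Implicit Defensive.

Import Order.TTheory GRing.Theory Num.Theory.
Import numFieldNormedType.Exports.

Local Open Scope classical_set_scope.
Local Open Scope ring_scope.

(* Vertices of the path 1 - 2 - ... - n are the ordinals of 'I_n, the vertex
   numbered k (1 <= k <= n) being the ordinal of value k.-1.  Natural numbers
   below (in index sets, entries, sums, products, s and M) are the numbers
   1..n. *)

Section lebesgue_tuple.
Context {R : realType}.

Definition cons_pair n
    (p : measurableTypeR R * n.-tuple (measurableTypeR R)) :
  n.+1.-tuple (measurableTypeR R) := [the n.+1.-tuple _ of p.1 :: p.2].

Lemma measurable_cons_pair n : measurable_fun setT (@cons_pair n).
Proof. exact: measurable_cons. Qed.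

Section cons_measure.
Variables (n : nat)
  (mu : {sigma_finite_measure set (n.-tuple (measurableTypeR R)) -> \bar R}).

Definition cons_measure : set (n.+1.-tuple (measurableTypeR R)) -> \bar R :=
  pushforward (lebesgue_measure \x mu)%E (@cons_pair n).

Let cons_measure0 : cons_measure set0 = 0%E.
Proof. by rewrite /cons_measure /pushforward preimage_set0 measure0. Qed.

Let cons_measure_ge0 A : (0 <= cons_measure A)%E.
Proof. by rewrite /cons_measure /pushforward measure_ge0. Qed.

Let cons_measure_sigma_additive : semi_sigma_additive cons_measure.
Proof.
move=> F mF tF mUF; rewrite /cons_measure /pushforward preimage_bigcup.
apply: measure_semi_sigma_additive.
- by move=> k; rewrite -[X in measurable X]setTI; exact: measurable_cons_pair.
- apply/trivIsetP => /= i j _ _ ij; rewrite -preimage_setI.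
  by move/trivIsetP : tF => /(_ _ _ _ _ ij) ->//; rewrite preimage_set0.
- rewrite -preimage_bigcup -[X in measurable X]setTI.
  exact: measurable_cons_pair.
Qed.

HB.instance Definition _ := isMeasure.Build _ _ _ cons_measure
  cons_measure0 cons_measure_ge0 cons_measure_sigma_additive.

Let cons_measure_sigma_finite : sigma_finite setT cons_measure.
Proof.
have /sigma_finiteP[F [TF ndF Foo]] := sigma_finiteT (@lebesgue_measure R).
have /sigma_finiteP[G [TG ndG Goo]] := sigma_finiteT mu.
pose u (t : n.+1.-tuple (measurableTypeR R)) :
  measurableTypeR R * n.-tuple (measurableTypeR R) :=
  (thead t, [tuple of behead t]).
have mu_ : measurable_fun setT u.
  apply/measurable_fun_pairP; split; last exact: measurable_behead.
  exact: (@measurable_tnth _ (measurableTypeR R) n.+1 ord0).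
have cu p : u (cons_pair p) = p.
  by case: p => x t; rewrite /u; congr pair; exact: val_inj.
exists (fun i => u @^-1` (F i `*` G i)).
  apply/seteqP; split=> // t _.
  have [a _ Fa] : (\bigcup_i F i) (u t).1 by rewrite -TF.
  have [b _ Gb] : (\bigcup_i G i) (u t).2 by rewrite -TG.
  exists (maxn a b) => //; split.
  - by apply: (subsetPset _ _ (ndF _ _ (leq_maxl a b))).
  - by apply: (subsetPset _ _ (ndG _ _ (leq_maxr a b))).
move=> i; have [mF Fi] := Foo i; have [mG Gi] := Goo i; split.
  by rewrite -[X in measurable X]setTI; apply: mu_ => //; exact: measurableX.
rewrite /cons_measure /pushforward -comp_preimage.
rewrite (_ : u \o _ = id); last by apply/funext => p /=; exact: cu.
by rewrite preimage_id product_measure1E// lte_mul_pinfty// ge0_fin_numE.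
Qed.

HB.instance Definition _ := Measure_isSigmaFinite.Build _ _ _ cons_measure
  cons_measure_sigma_finite.

End cons_measure.

(* Lebesgue measure on R^n. *)
Fixpoint lebesgue_tuple n :
    {sigma_finite_measure set (n.-tuple (measurableTypeR R)) -> \bar R} :=
  if n is k.+1 then cons_measure (lebesgue_tuple k)
  else \d_ ([tuple] : 0.-tuple (measurableTypeR R)).

End lebesgue_tuple.
Arguments lebesgue_tuple R n : clear implicits.

Section wishart_path.
Context {R : realType}.
Implicit Types n M k : nat.

Definition path_edge n (i j : 'I_n) : bool := (i <= j.+1)%N && (j <= i.+1)%N.

Definition ZG n : set 'M[R]_n :=
  [set y | y^T = y /\ forall i j, ~~ path_edge i j -> y i j = 0].

Definition PG n : set 'M[R]_n :=
  [set y | ZG y /\ forall v : 'cV[R]_n, v != 0 -> 0 < (v^T *m y *m v) 0 0].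

(* The space of incomplete symmetric matrices, in the coordinates
   ((eta_11, ..., eta_nn), (eta_12, ..., eta_{n-1,n})). *)
Definition IG n : Type :=
  (n.-tuple (measurableTypeR R) * n.-1.-tuple (measurableTypeR R))%type.

Definition lebesgue_IG n : {measure set (IG n) -> \bar R} :=
  (lebesgue_tuple R n \x lebesgue_tuple R n.-1)%E.

(* The entries eta_ij, (i, j) being an edge; the unspecified entries are
   filled with 0 and are never used. *)
Definition IGmx n (eta : IG n) : 'M[R]_n :=
  \matrix_(i, j) if i == j then tnth eta.1 i
                 else if j == i.+1 :> nat then nth 0 (eta.2 : seq R) i
                 else if i == j.+1 :> nat then nth 0 (eta.2 : seq R) j
                 else 0.

Definition pairing n (y : 'M[R]_n) (eta : IG n) : R :=
  \sum_(i < n) \sum_(j < n | path_edge i j) y i j * IGmx eta i j.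

Definition QG n : set (IG n) :=
  [set eta | forall y, closure (@PG n) y -> y != 0 -> 0 < pairing y eta].

(* {i : j} *)
Definition interval_set n i j : {set 'I_n} :=
  [set k : 'I_n | (i <= k.+1 <= j)%N]%SET.

(* eta_B, indexed by an enumeration of B in increasing order *)
Definition sub_block n (A : 'M[R]_n) (B : {set 'I_n}) : 'M[R]_#|B| :=
  \matrix_(a, b) A (enum_val a) (enum_val b).

(* K^0; each entry is a sum of at most one term. *)
Definition zero_ext n (B : {set 'I_n}) (K : 'M[R]_#|B|) : 'M[R]_n :=
  \matrix_(i, j) \sum_(a | enum_val a == i) \sum_(b | enum_val b == j) K a b.

Definition block n (eta : IG n) i j := sub_block (IGmx eta) (interval_set n i j).

Definition block_inv0 n (eta : IG n) i j : 'M[R]_n :=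
  zero_ext (invmx (block eta i j)).

Definition diag_entry n (eta : IG n) k : R :=
  if insub k.-1 is Some i then tnth eta.1 i else 0.

Definition diag_inv0 n (eta : IG n) k : 'M[R]_n :=
  \matrix_(i, j) if (i.+1 == k) && (j.+1 == k) then (diag_entry eta k)^-1
                 else 0.

Definition delta n M (s : nat -> R) (eta : IG n) : R :=
  ((\prod_(1 <= i < M) (\det (block eta i i.+1)) `^ (s i)) *
   (\prod_(M.+1 <= i < n.+1) (\det (block eta i.-1 i)) `^ (s i))) /
  ((\prod_(2 <= i < M) (diag_entry eta i) `^ (s i.-1)) *
   (diag_entry eta M) `^ (s M.-1 - s M + s M.+1) *
   (\prod_(M.+1 <= i < n) (diag_entry eta i) `^ (s i.+1))).

Definition phi n (eta : IG n) : R :=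
  (\prod_(1 <= i < n) (\det (block eta i i.+1)) `^ (- (3 / 2))) *
  (\prod_(2 <= i < n) diag_entry eta i).

Definition wishart_weight n M (s : nat -> R) (y : 'M[R]_n) (eta : IG n) : R :=
  expR (- pairing y eta) * delta M s eta * phi eta.

(* P is a probability measure carried by QG whose density is proportional to
   the weight. *)
Definition is_wishart n M (s : nat -> R) (y : 'M[R]_n)
    (P : probability (IG n) R) : Prop :=
  exists c : R, forall A, measurable A ->
    P A = (\int[lebesgue_IG n]_(eta in A `&` @QG n)
             (c * wishart_weight M s y eta)%:E)%E.

(* The unique such P for y in PG; the Dirac mass is a dummy value. *)
Definition wishart n M (s : nat -> R) (y : 'M[R]_n) : probability (IG n) R :=
  xget (\d_ (point : IG n) : probability (IG n) R) [set P | is_wishart M s y P].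

Definition wishart_mean n M (s : nat -> R) (y : 'M[R]_n) : IG n :=
  ([tuple \int[wishart M s y]_(eta in @QG n) tnth eta.1 i | i < n],
   [tuple \int[wishart M s y]_(eta in @QG n) tnth eta.2 i | i < n.-1]).

(* The inverse of wishart_mean on PG; 0 is the dummy value outside the image
   of PG. *)
Definition wishart_inverse_mean n M (s : nat -> R) : IG n -> 'M[R]_n :=
  'pinv_(fun=> 0) (@PG n) (@wishart_mean n M s).

End wishart_path.

(* Main.v *)
Require Import Defs.
From HB Require Import structures.
From mathcomp Require Import all_boot all_order all_algebra.
From mathcomp Require Import zify ring lra.
From mathcomp Require Import all_classical all_reals all_analysis.
From mathcomp Require Import measurable_realfun.

(** Orient the path towards its root [M].  For an incomplete matrix write [a i]
    for the diagonal entries and [x j] for the entry on the edge [j], which joins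
    the vertices [j] and [j.+1]; one end of the edge, its parent [p], is nearer to
    the root, the other one is its child [c].

    Eliminating the vertices from the two ends towards the root (a Cholesky
    factorisation without fill-in) shows that the positive definite [y] are those
    for which [tr (y eta)] has the form
      [r * a M + \sum_j e j * (a c + 2 * b j * x j + b j ^+ 2 * a p)]
    with [r] and all [e j] positive ([tridiag_elim], [chain_form_posdef]).  In the
    parameters [(r, e, b)] the weight is the density of a Markov chain started at
    the root: a Gamma factor in [a M], and for every edge a factor in [(x j, a c)]
    that, given [a p], is Gaussian in [x j] and Gamma in [a c - x j ^+ 2 / a p].
    The integral of an edge factor is a constant times [e j `^ - s c], whatever
    [a p] is ([integral_edge_density]), so Tonelli yields the total mass
    [C * r `^ - s M * \prod_j e j `^ - s c] ([integral_chain_density]).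

    The Laplace transform of the law is therefore a quotient of such products
    ([wishart_laplace]).  Integrating [1 + X <= expR X] bounds the mean from one
    side by the Laplace transform; moving one parameter at a time in both
    directions turns the bounds into equalities ([gamma_mean] for [r] and [e j],
    [centered_mean] for [b j]).  The mean [m] is thus characterised by
      [m M = s M / r],  [m j = - b j * m p],  [m c = s c / e j + b j ^+ 2 * m p].
    These equations have a solution [(r, e, b)] with [r] and [e] positive exactly
    when [m] lies in the dual cone, which is cut out by the positivity of the
    diagonal entries and of the minors of consecutive vertices ([QGE]); the
    solution is then unique, so the mean map is bijective.

    Finally [s c] times the inverse of the block of an edge defines the form
    [e j * (a c + 2 * b j * x j + b j ^+ 2 * a p) + s c * a p / m p].  Summed over
    the edges, the last terms are cancelled by the diagonal corrections of the
    formula, up to [s M * a M / m M = r * a M] ([sum_edge_parent]). *)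

Set Implicit Arguments.
Unset Strict Implicit.
Unset Printing Implicit Defensive.

Import Order.TTheory GRing.Theory Num.Theory.
Import numFieldNormedType.Exports.
Local Open Scope classical_set_scope.
Local Open Scope ring_scope.

(** * Linear changes of variable and the Gamma integral *)

Lemma integral_indicM disp (T : measurableType disp) (R : realType)
    (mu : {measure set T -> \bar R}) (D : set T) (f : T -> R) :
  (\int[mu]_x (\1_D x * f x)%:E = \int[mu]_(x in D) (f x)%:E)%E.
Proof.
rewrite [RHS]integral_mkcond epatch_indic; apply: eq_integral => x _.
by rewrite EFinM muleC.
Qed.

Section real_line.
Context {R : realType}.
Local Notation leb := (@lebesgue_measure R).
Implicit Types (a b d k : R).

Section affine.
Local Open Scope ereal_scope.
Variables (a b : R) (a0 : (0 < a)%R).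

Let aff (x : measurableTypeR R) : measurableTypeR R := (a * x + b)%R.

Let measurable_aff : measurable_fun setT aff.
Proof. by apply: measurable_funD => //; exact: measurable_funM. Qed.

Lemma ge0_integral_affine (f : R -> \bar R) :
    measurable_fun setT f -> (forall x, 0 <= f x) ->
  \int[leb]_x f (a * x + b)%R = a^-1%:E * \int[leb]_x f x.
Proof.
move=> mf f0.
have [P PE] : exists P : {measure set (measurableTypeR R) -> \bar R},
    forall A, P A = pushforward leb aff A.
  by unshelve eexists (pushforward leb aff : {measure set (measurableTypeR R) -> \bar R}).
pose mu' := mscale (NngNum (ltW a0)) P.
have -> : \int[leb]_x f x = \int[mu']_x f x.
  apply: eq_measure_integral => A mA _.
  apply: lebesgue_measure_unique => //= _ [[u v]] _ <-.
  rewrite /mu' /mscale /= PE /pushforward.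
  have -> : aff @^-1` `]u, v] = `]((u - b) / a)%R, ((v - b) / a)%R]%classic.
    apply/seteqP; split => x /=; rewrite !in_itv/= /aff ltr_pdivrMr// ler_pdivlMr//;
      by rewrite ltrBlDr lerBrDr mulrC.
  rewrite !lebesgue_measure_itv/= !lte_fin ltr_pM2r ?invr_gt0// ltrD2r.
  case: ifP => _; last by rewrite mule0.
  by rewrite -!EFinB -EFinM; congr EFin; field; rewrite gt_eqF.
rewrite ge0_integral_mscale//=.
rewrite [in RHS](eq_measure_integral (pushforward leb aff)) => [|A _ _]; last exact: PE.
rewrite ge0_integral_pushforward//.
by rewrite muleA -EFinM mulVf ?mul1e ?gt_eqF.
Qed.

End affine.

(** The bound does not depend on the left end, so it survives the limit at [0]. *)
Lemma integral_powR_0n1 k n : 0 < k ->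
  (\int[leb]_(x in `[(n.+1%:R^-1)%R, 1%R]) (x `^ (k - 1))%:E <= (k^-1)%:E)%E.
Proof.
move=> k0; set e : R := n.+1%:R^-1.
have e0 : 0 < e :> R by rewrite invr_gt0.
have e1 : e <= 1 by rewrite invf_le1 // ler1n.
have [->|en1] := eqVneq e 1.
  by rewrite set_itv1 integral_set1 lee_fin invr_ge0 ltW.
have elt1 : e < 1 by rewrite lt_neqAle en1.
pose F x := k^-1 * x `^ k.
have dF (x : R) : 0 < x -> is_derive x 1 F (x `^ (k - 1)).
  move=> x0; have := is_derive1_powR k x0 => dp.
  apply: is_derive_eq.
  by rewrite /GRing.scale /= mulrA mulVf ?mul1r// gt_eqF.
have cF (x : R) : 0 < x -> {for x, continuous F}.
  by move=> x0; apply/differentiable_continuous/derivable1_diffP; case: (dF _ x0).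
rewrite (@continuous_FTC2 _ _ F)//.
- rewrite -EFinB lee_fin /F powR1 mulr1 lerBlDr lerDl.
  by rewrite mulr_ge0 ?powR_ge0// invr_ge0 ltW.
- apply: continuous_in_subspaceT => x; rewrite inE/= in_itv/= => /andP[ex _].
  have x0 : 0 < x by exact: lt_le_trans ex.
  apply/differentiable_continuous/derivable1_diffP.
  by apply: derivable_powR; rewrite in_itv/= x0.
- split.
  + by move=> x; rewrite in_itv/= => /andP[ex _]; case: (dF x (lt_trans e0 ex)).
  + by apply: cvg_at_right_filter; exact: cF.
  + by apply: cvg_at_left_filter; exact: cF.
- move=> x; rewrite in_itv/= => /andP[ex _].
  by rewrite derive1E; case: (dF x (lt_trans e0 ex)).
Qed.

Lemma integral_powR_01 k : 0 < k ->
  (\int[leb]_(x in `]0%R, 1%R]) (x `^ (k - 1))%:E <= (k^-1)%:E)%E.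
Proof.
move=> k0.
pose F n : set (measurableTypeR R) := `[n.+1%:R^-1, 1]%classic.
have mF n : measurable (F n) by rewrite /F; exact: measurable_itv.
have ndF : nondecreasing_seq F.
  move=> m n mn; apply/subsetPset => x; rewrite /F/= !in_itv/= => /andP[mx ->].
  by rewrite andbT (le_trans _ mx)// lef_pV2 ?posrE// ler_nat.
have -> : `]0, 1]%classic = \bigcup_n F n.
  apply/seteqP; split => x /=.
    rewrite in_itv/= => /andP[x0 x1].
    exists (Num.trunc x^-1) => //; rewrite /F/= in_itv/= x1 andbT.
    rewrite -[leRHS]invrK lef_pV2 ?posrE ?invr_gt0//.
    by rewrite ltW//; exact: truncnS_gt.
  move=> [n _]; rewrite /F/= !in_itv/= => /andP[nx ->]; rewrite andbT.
  by rewrite (lt_le_trans _ nx)// invr_gt0.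
have mp n : measurable_fun (F n) (fun x => (x `^ (k - 1))%:E).
  by apply/measurable_funTS/measurable_EFinP.
have p0 n (x : R) : F n x -> (0 <= (x `^ (k - 1))%:E)%E.
  by move=> _; rewrite lee_fin powR_ge0.
have H := @ge0_nondecreasing_set_cvg_integral _ _ _ F _ leb ndF mF mp p0.
rewrite -(cvg_lim _ H)//; apply: lime_le; first by apply/cvg_ex; eexists; exact: H.
by apply: nearW => n; exact: integral_powR_0n1.
Qed.

(** The indicator makes the integrand vanish on the negative half-line, where
    [`^] takes unrelated values. *)
Definition gamma_fun k (x : R) : R := (0 < x)%R%:R * (x `^ (k - 1) * expR (- x)).

Lemma gamma_fun_ge0 k x : 0 <= gamma_fun k x.
Proof. by rewrite mulr_ge0 ?mulr_ge0 ?powR_ge0 ?expR_ge0. Qed.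

Lemma measurable_gt0b disp (T : measurableType disp) (f : T -> R) :
  measurable_fun setT f -> measurable_fun setT (fun t => (0 < f t)%R%:R : R).
Proof.
move=> mf; rewrite (_ : (fun _ => _) = fun t => if 0 < f t then 1 else 0).
  by apply: measurable_fun_ifT => //; exact: measurable_fun_ltr.
by apply/funext => t; case: ifP.
Qed.

Lemma measurable_gamma_fun k : measurable_fun setT (gamma_fun k).
Proof.
apply: measurable_funM; first exact: measurable_gt0b.
apply: measurable_funM => //.
by apply: measurableT_comp => //.
Qed.

(** Near [0] the power is the main term, and it is integrable as [0 < k]; at
    infinity any power is absorbed by half of the exponential. *)
Lemma gamma_fun_le k : exists2 C, 0 <= C & forall x, 0 < x ->
  gamma_fun k x <= \1_(`]0, 1]) x * x `^ (k - 1) + C * exponential_pdf 2^-1 x.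
Proof.
have [m km] : exists m, k - 1 <= m.+1%:R.
  exists (Num.trunc (k - 1)); rewrite ltW//; exact: truncnS_gt.
have C0 : 0 <= 2 ^+ m.+2 * m.+1`!%:R :> R.
  by apply: mulr_ge0; rewrite ?exprn_ge0 ?ler0n.
exists (2 ^+ m.+2 * m.+1`!%:R) => // x x0; rewrite /gamma_fun x0 mul1r.
have [x1|x1] := leP x 1.
  rewrite indicE mem_set ?mul1r/= ?in_itv/= ?x0//.
  rewrite -[leLHS]addr0 lerD//.
    by rewrite ler_piMr ?powR_ge0// expR_le1 oppr_le0 ltW.
  by apply: mulr_ge0; [exact: C0|exact: exponential_pdf_ge0].
rewrite indicE memNset /=; last by rewrite in_itv/= x0 leNgt x1.
rewrite mul0r add0r (exponential_pdfE _ (ltW x0)).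
have -> e : 2 ^+ m.+2 * m.+1`!%:R * (2^-1 * e) = 2 ^+ m.+1 * m.+1`!%:R * e :> R.
  by rewrite [in LHS]exprS; field.
have -> : - x = - 2^-1 * x + - 2^-1 * x by field.
rewrite expRD mulrA ler_pM2r ?expR_gt0//.
have xm : x `^ (k - 1) <= x ^+ m.+1.
  by rewrite -powR_mulrn ?(ltW x0)// ler_powR// ltW.
apply: (le_trans (ler_wpM2r (expR_ge0 _) xm)).
rewrite mulNr expRN ler_pdivrMr ?expR_gt0//.
have := @expR_ge1Dxn _ (2^-1 * x) m.
have xx : 0 <= 2^-1 * x by rewrite mulr_ge0 ?invr_ge0 ?(ltW x0).
move=> /(_ xx) H.
rewrite -ler_pdivrMl ?mulr_gt0 ?exprn_gt0 ?ltr0n ?fact_gt0//.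
apply: le_trans H; rewrite exprMn exprVn invfM.
rewrite ler_wpDl//; by rewrite mulrAC.
Qed.

(** The value is Gamma(k).  It is finite by [gamma_fun_le], and positive because
    the integrand is bounded away from [0] on [[1, 2]]. *)
Lemma integral_gamma_fun k : 0 < k ->
  exists2 G : R, 0 < G & (\int[leb]_x (gamma_fun k x)%:E = G%:E)%E.
Proof.
move=> k0.
have mg := measurable_gamma_fun k.
have g0 x := gamma_fun_ge0 k x.
have fin : (\int[leb]_x (gamma_fun k x)%:E < +oo)%E.
  have [C C0 gC] := gamma_fun_le k.
  have me : measurable_fun setT (exponential_pdf (2^-1 : R)).
    exact: measurable_exponential_pdf.
  apply: (@le_lt_trans _ _ (\int[leb]_x ((\1_(`]0%R, 1%R]) x * x `^ (k - 1))%:E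
    + (C * exponential_pdf 2^-1 x)%:E))%E).
    apply: ge0_le_integral => //=.
    - by move=> x _; rewrite lee_fin.
    - exact/measurable_EFinP.
    - apply/measurable_EFinP; apply: measurable_funD; apply: measurable_funM => //.
    - move=> x _; rewrite -EFinD lee_fin.
      have [x0|x0] := leP x 0; last exact: gC.
      rewrite /gamma_fun ltNge x0 mul0r; apply: addr_ge0; first by rewrite mulr_ge0 ?powR_ge0.
      by apply: mulr_ge0; [exact: C0|exact: exponential_pdf_ge0].
  rewrite ge0_integralD//=.
  - apply: lte_add_pinfty.
    + rewrite integral_indicM.
      by apply: le_lt_trans (integral_powR_01 k0) _; rewrite ltry.
    + under eq_integral do rewrite EFinM.
      rewrite ge0_integralZl//.
      * by rewrite integral_exponential_pdf// mule1 ltry.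
      * exact/measurable_EFinP.
      * by move=> x _; rewrite lee_fin exponential_pdf_ge0.
  - by move=> x _; rewrite lee_fin mulr_ge0 ?powR_ge0.
  - by apply/measurable_EFinP; apply: measurable_funM.
  - move=> x _; rewrite lee_fin.
    by apply: mulr_ge0; [exact: C0|exact: exponential_pdf_ge0].
  - by apply/measurable_EFinP; apply: measurable_funM.
have pos : (0 < \int[leb]_x (gamma_fun k x)%:E)%E.
  pose c := Num.min 1 (2 `^ (k - 1)) * expR (- 2).
  have c0 : 0 < c.
    by rewrite mulr_gt0 ?expR_gt0// lt_min ltr01 powR_gt0.
  apply: (@lt_le_trans _ _ (\int[leb]_(x in `[1%R, 2%R]) c%:E)%E).
    rewrite integral_cst//= lebesgue_measure_itv/= lte_fin ltr1n.
    by rewrite -EFinB -EFinM lte_fin mulr_gt0// subr_gt0 ltr1n.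
  apply: (@le_trans _ _ (\int[leb]_(x in `[1%R, 2%R]) (gamma_fun k x)%:E)%E).
    apply: ge0_le_integral => //=.
    - by move=> x _; rewrite lee_fin ltW.
    - by apply/measurable_EFinP; apply: measurable_funS mg.
    - move=> x; rewrite in_itv/= => /andP[x1 x2].
      have x0 : 0 < x by exact: lt_le_trans x1.
      rewrite lee_fin /gamma_fun x0 mul1r.
      have m0 : 0 <= Num.min 1 (2 `^ (k - 1)) :> R.
        by rewrite le_min ler01 powR_ge0.
      apply: ler_pM => //; last by rewrite ler_expR lerN2.
      have [k1|k1] := leP 0 (k - 1).
        by rewrite ge_min -[X in X <= _](powRr0 x) ler_powR.
      rewrite ge_min; apply/orP; right.
      have [u u0 ->] : exists2 u, 0 <= u & k - 1 = - u.
        by exists (- (k - 1)); rewrite ?opprK// oppr_ge0 ltW.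
      rewrite !powRN lef_pV2 ?posrE ?powR_gt0//.
      by rewrite ge0_ler_powR// nnegrE ltW.
  apply: ge0_subset_integral => //=.
  - exact/measurable_EFinP.
  - by move=> x _; rewrite lee_fin.
exists (fine (\int[leb]_x (gamma_fun k x)%:E)%E); first by rewrite fine_gt0 ?pos.
by rewrite fineK// ge0_fin_numE// ltW.
Qed.

End real_line.

(** * The law of an edge and its child vertex, given the parent *)

Section edge_kernel.
Context {R : realType}.
Local Notation leb := (@lebesgue_measure R).
Implicit Types (s d b a x c : R).

(** Unnormalised joint density of the entry [x] of an edge and of its child [c],
    given the parent [a].  The two indicators encode the cone. *)
Definition edge_density s d b a x c : R :=
  (0 < a)%R%:R * (0 < c - x ^+ 2 / a)%R%:R *
  ((c - x ^+ 2 / a) `^ (s - 3 / 2) * (Num.sqrt a)^-1 *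
   expR (- (d * (c + 2 * b * x + b ^+ 2 * a)))).

Lemma edge_density_ge0 s d b a x c : 0 <= edge_density s d b a x c.
Proof. by rewrite !mulr_ge0 ?powR_ge0 ?expR_ge0 ?invr_ge0 ?sqrtr_ge0. Qed.

Lemma measurable_edge_density s d b disp (T : measurableType disp)
    (f g h : T -> R) :
  measurable_fun setT f -> measurable_fun setT g -> measurable_fun setT h ->
  measurable_fun setT (fun t => edge_density s d b (f t) (g t) (h t)).
Proof.
move=> mf mg mh.
(* on the support of the indicator the quotient is a power with exponent -1,
   and powers are measurable *)
have mV : measurable_fun setT (fun t => h t - g t ^+ 2 / f t * (0 < f t)%R%:R).
  apply: measurable_funB => //.
  rewrite (_ : (fun _ => _) = fun t => g t ^+ 2 * (f t `^ (-1) * (0 < f t)%R%:R)).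
    apply: measurable_funM; first exact: measurable_funX.
    apply: measurable_funM; last exact: measurable_gt0b.
    by apply: (@measurableT_comp _ _ _ _ _ _ (@powR R ^~ _)); first exact: measurable_powR.
  apply/funext => t; rewrite -mulrA; congr (_ * _).
  by case: ltP => // f0; rewrite ?mulr0// powR_inv1// ltW.
pose v t := h t - g t ^+ 2 / f t * (0 < f t)%R%:R.
rewrite (_ : (fun _ => _) = fun t => (0 < f t)%R%:R * (0 < v t)%R%:R *
   (v t `^ (s - 3 / 2) * (Num.sqrt (f t)) `^ (-1) *
   expR (- (d * (h t + 2 * b * g t + b ^+ 2 * f t))))); last first.
  apply/funext => t; rewrite /edge_density /v.
  by case: ltP => // f0; rewrite ?mul0r// mulr1 powR_inv1 ?sqrtr_ge0.
apply: measurable_funM.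
  by apply: measurable_funM; exact: measurable_gt0b.
apply: measurable_funM.
  apply: measurable_funM.
    by apply: (@measurableT_comp _ _ _ _ _ _ (@powR R ^~ _)); first exact: measurable_powR.
  apply: (@measurableT_comp _ _ _ _ _ _ (@powR R ^~ _) _ (fun t => Num.sqrt (f t))); first exact: measurable_powR.
  apply: (@measurableT_comp _ _ _ _ _ _ (@Num.sqrt R)) => //.
  by apply: continuous_measurable_fun; exact: sqrt_continuous.
apply: measurableT_comp => //; apply: measurable_funN.
apply: measurable_funM => //; apply: measurable_funD.
  by apply: measurable_funD => //; exact: measurable_funM.
exact: measurable_funM.
Qed.

Lemma edge_density_gt0 s d b a x c : 0 < a -> 0 < c * a - x ^+ 2 ->
  edge_density s d b a x c =
  (c - x ^+ 2 / a) `^ (s - 3 / 2) * (Num.sqrt a)^-1 *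
   expR (- (d * (c + 2 * b * x + b ^+ 2 * a))).
Proof.
move=> a0 ca; rewrite /edge_density a0 (_ : 0 < _ - _) ?mul1r//.
by rewrite subr_gt0 ltr_pdivrMr// -subr_gt0.
Qed.

Lemma edge_density_eq0 s d b a x c : ~~ ((0 < a) && (0 < c * a - x ^+ 2)) ->
  edge_density s d b a x c = 0.
Proof.
rewrite /edge_density; case: ltP => a0 /=; last by rewrite !mul0r.
rewrite subr_gt0 -ltr_pdivrMr// -subr_gt0 => /negbTE ->.
by rewrite mulr0 mul0r.
Qed.

(** Completing the square in [x]:
    [c + 2 b x + b^2 a = (x + b a)^2 / a + (c - x^2 / a)], so the density factors
    into a Gaussian in [x] and a Gamma density in [c - x^2 / a]. *)
Lemma edge_densityE s d b a x c : 0 < a -> 0 < d ->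
  edge_density s d b a x c =
  ((Num.sqrt a)^-1 * d `^ (- (s - 3 / 2)) *
   gauss_fun (Num.sqrt (d / a) * x + Num.sqrt (d / a) * (b * a))) *
  gamma_fun (s - 1 / 2) (d * c + - (d * (x ^+ 2 / a))).
Proof.
move=> a0 d0; rewrite /edge_density a0 mul1r /gamma_fun -mulrBr pmulr_rgt0//.
case: ltP => t0; last by rewrite !(mul0r,mulr0).
rewrite !mul1r /gauss_fun -mulrDr exprMn sqr_sqrtr ?divr_ge0 ?(ltW a0, ltW d0)//.
rewrite (_ : s - 2^-1 - 1 = s - 3 / 2); last by field.
rewrite powRM ?(ltW t0) ?(ltW d0)// powRN.
have p0 : d `^ (s - 3 / 2) != 0 by rewrite gt_eqF ?powR_gt0.
rewrite (_ : - (d * (c + _ + _)) =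
  - (d / a * (x + b * a) ^+ 2) + - (d * (c - x ^+ 2 / a))); last first.
  by field; rewrite gt_eqF.
rewrite expRD; field; rewrite p0 /=.
by rewrite sqrtr_eq0 -ltNge.
Qed.

(** The Gaussian integral is proportional to [Num.sqrt a], which cancels the
    factor [(Num.sqrt a)^-1] of the density: the value does not depend on the
    parent [a], nor on the centring [b]. *)
Lemma integral_edge_density s : 1 / 2 < s -> exists2 C : R, 0 < C &
  forall d b a, 0 < d -> 0 < a ->
    (\int[leb]_x \int[leb]_c (edge_density s d b a x c)%:E = (C * d `^ (- s))%:E)%E.
Proof.
move=> s2; have k0 : 0 < s - 1 / 2 by rewrite subr_gt0.
have [G G0 GE] := integral_gamma_fun k0.
exists (G * Num.sqrt pi); first by rewrite mulr_gt0// sqrtr_gt0 pi_gt0.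
move=> d b a d0 a0.
have al0 : 0 < Num.sqrt (d / a) by rewrite sqrtr_gt0 divr_gt0.
set al := Num.sqrt (d / a) in al0.
pose K : R := (Num.sqrt a)^-1 * d `^ (- (s - 3 / 2)).
have K0 : 0 <= K by rewrite mulr_ge0 ?invr_ge0 ?sqrtr_ge0 ?powR_ge0.
have inner x : (\int[leb]_c (edge_density s d b a x c)%:E =
    (K * gauss_fun (al * x + al * (b * a)) * (d^-1 * G))%:E)%E.
  under eq_integral do rewrite edge_densityE// EFinM.
  rewrite ge0_integralZl//=.
  - rewrite (@ge0_integral_affine _ d (- (d * (x ^+ 2 / a))) d0
      (fun y => (gamma_fun (s - 1 / 2) y)%:E)).
    + by rewrite GE -!EFinM.
    + by apply/measurable_EFinP; exact: measurable_gamma_fun.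
    + by move=> y; rewrite lee_fin gamma_fun_ge0.
  - apply/measurable_EFinP.
    apply: measurableT_comp; first exact: measurable_gamma_fun.
    by apply: measurable_funD => //; exact: measurable_funM.
  - by move=> y _; rewrite lee_fin gamma_fun_ge0.
  - by rewrite lee_fin mulr_ge0 ?gauss_fun_ge0.
under eq_integral do rewrite inner mulrAC EFinM.
rewrite ge0_integralZl//=.
- rewrite (@ge0_integral_affine _ al (al * (b * a)) al0 (fun y => (gauss_fun y)%:E)).
  + rewrite integralT_gauss -!EFinM; congr EFin.
    rewrite /K /al sqrtrM ?(ltW d0)// sqrtrV ?(ltW a0)//.
    rewrite (_ : - s = - (s - 3 / 2) - 1 - 1 / 2); last by field.
    have dn0 : d != 0 by rewrite gt_eqF.
    rewrite !powRD ?dn0 ?implybT//.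
    have -> : d `^ (- 1) = d^-1 by rewrite powR_inv1// ltW.
    have -> : d `^ (- (1 / 2)) = (Num.sqrt d)^-1.
      by rewrite powRN div1r powR12_sqrt// ltW.
    have sa0 : Num.sqrt a != 0 by rewrite gt_eqF// sqrtr_gt0.
    have sd0 : Num.sqrt d != 0 by rewrite gt_eqF// sqrtr_gt0.
    field; by rewrite dn0 sa0 sd0.
  + by apply/measurable_EFinP; exact: measurable_gauss_fun.
  + by move=> y; rewrite lee_fin gauss_fun_ge0.
- apply/measurable_EFinP.
  apply: measurableT_comp; first exact: measurable_gauss_fun.
  by apply: measurable_funD => //; exact: measurable_funM.
- by move=> y _; rewrite lee_fin gauss_fun_ge0.
- by rewrite lee_fin mulr_ge0// mulr_ge0 ?invr_ge0 ?(ltW d0) ?(ltW G0).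
Qed.

Definition root_density s d a : R :=
  (0 < a)%R%:R * (a `^ (s - 1) * expR (- (d * a))).

Lemma root_density_ge0 s d a : 0 <= root_density s d a.
Proof. by rewrite mulr_ge0 ?mulr_ge0 ?powR_ge0 ?expR_ge0. Qed.

Lemma measurable_root_density s d disp (T : measurableType disp) (f : T -> R) :
  measurable_fun setT f -> measurable_fun setT (fun t => root_density s d (f t)).
Proof.
move=> mf; apply: measurable_funM; first exact: measurable_gt0b.
apply: measurable_funM.
  by apply: (@measurableT_comp _ _ _ _ _ _ (@powR R ^~ _)); first exact: measurable_powR.
by apply: measurableT_comp => //; apply: measurable_funN; exact: measurable_funM.
Qed.

Lemma integral_root_density s : 0 < s -> exists2 C : R, 0 < C &
  forall d, 0 < d ->
    (\int[leb]_a (root_density s d a)%:E = (C * d `^ (- s))%:E)%E.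
Proof.
move=> s0; have [G G0 GE] := integral_gamma_fun s0.
exists G => // d d0.
have -> : (\int[leb]_a (root_density s d a)%:E =
    \int[leb]_a ((d `^ (- (s - 1)))%:E * (gamma_fun s (d * a + 0))%:E))%E.
  apply: eq_integral => a _; rewrite -EFinM; congr EFin.
  rewrite /root_density /gamma_fun addr0 pmulr_rgt0//.
  case: ltP => a0; rewrite ?mul0r ?mulr0// !mul1r powRM ?(ltW a0) ?(ltW d0)//.
  rewrite mulrA mulrA -powRD; last by rewrite (gt_eqF d0) implybT.
  by rewrite addNr powRr0 mul1r.
have mg := @measurable_gamma_fun R s.
rewrite ge0_integralZl//=.
- rewrite (@ge0_integral_affine _ d 0 d0 (fun y => (gamma_fun s y)%:E)).
  + rewrite GE -!EFinM; congr EFin.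
    rewrite -(powR_inv1 (ltW d0)) mulrA -powRD; last by rewrite (gt_eqF d0) implybT.
    by rewrite mulrC; congr (_ * _ `^ _); ring.
  + exact/measurable_EFinP.
  + by move=> y; rewrite lee_fin gamma_fun_ge0.
- apply/measurable_EFinP; apply: measurableT_comp => //.
  by apply: measurable_funD => //; exact: measurable_funM.
- by move=> y _; rewrite lee_fin gamma_fun_ge0.
- by rewrite lee_fin powR_ge0.
Qed.

End edge_kernel.

(** * Chain densities and their total mass *)

Section tonelli.
Local Open Scope ereal_scope.
Context d1 d2 (T1 : measurableType d1) (T2 : measurableType d2) (R : realType).
Variables (m1 : {sigma_finite_measure set T1 -> \bar R})
  (m2 : {sigma_finite_measure set T2 -> \bar R}) (f : T1 -> T2 -> \bar R).
Hypotheses (mf : measurable_fun setT (fun z => f z.1 z.2))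
  (f0 : forall x y, 0 <= f x y).

Lemma tonelli_swap :
  \int[m1]_x \int[m2]_y f x y = \int[m2]_y \int[m1]_x f x y.
Proof. by apply: (@fubini_tonelli _ _ _ _ _ m1 m2 _ mf) => -[x y]; exact: f0. Qed.

Lemma measurable_integral2 : measurable_fun setT (fun x => \int[m2]_y f x y).
Proof.
by apply: (@measurable_fun_fubini_tonelli_F _ _ _ _ _ m2 _ mf) => -[x y]; exact: f0.
Qed.

End tonelli.

Section lebesgue_tuple_cons.
Local Open Scope ereal_scope.
Context {R : realType}.
Local Notation leb := (@lebesgue_measure R).
Local Notation mu := (lebesgue_tuple R).
Local Notation RT := (measurableTypeR R).

Lemma integral_lebesgue_tuple0 (f : 0.-tuple RT -> \bar R) :
  measurable_fun setT f -> \int[mu 0%N]_t f t = f [tuple].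
Proof.
by move=> mf; rewrite /lebesgue_tuple integral_dirac// diracE mem_set// mul1e.
Qed.

Lemma integral_lebesgue_tupleS n (f : n.+1.-tuple RT -> \bar R) :
  measurable_fun setT f -> (forall t, 0 <= f t) ->
  \int[mu n.+1]_t f t = \int[leb]_a \int[mu n]_t f [tuple of a :: t].
Proof.
move=> mf f0.
rewrite (eq_measure_integral (pushforward (leb \x mu n)%E (@cons_pair R n)))//.
  exact: measurable_cons_pair.
move=> mc; rewrite ge0_integral_pushforward//.
rewrite preimage_setT fubini_tonelli1//.
  exact: measurableT_comp.
by move=> z; exact: f0.
Qed.

End lebesgue_tuple_cons.

Section chain_density.
Context {R : realType}.
Local Notation leb := (@lebesgue_measure R).
Local Notation mu := (lebesgue_tuple R).
Local Notation RT := (measurableTypeR R).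
Implicit Types (s e b : nat -> R) (N M k : nat).

Definition edge_parent M j := if (j < M)%N then j.+1 else j.
Definition edge_child M j := if (j < M)%N then j else j.+1.

Lemma leq_edge_parent N M j : (j < N)%N -> (edge_parent M j <= N)%N.
Proof. by rewrite /edge_parent; case: ifP => // _; exact: ltnW. Qed.

Lemma leq_edge_child N M j : (j < N)%N -> (edge_child M j <= N)%N.
Proof. by rewrite /edge_child; case: ifP => // _; exact: ltnW. Qed.

(** Here [M] is the root counted from [0], and [j] numbers the edge between the
    vertices [j] and [j.+1]; [s], [e] and [b] are indexed by edges. *)
Definition chain_density N M (s0 : R) s (r : R) e b (a x : nat -> R) : R :=
  root_density s0 r (a M) *
  \prod_(0 <= j < N) edge_density (s j) (e j) (b j)
    (a (edge_parent M j)) (x j) (a (edge_child M j)).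

Lemma measurable_nth_tuple disp (T : measurableType disp) n
    (f : T -> n.-tuple RT) i :
  measurable_fun setT f -> measurable_fun setT (fun t => nth 0 (f t : seq R) i).
Proof.
move=> mf; have [ni|ni] := ltnP i n.
  rewrite (_ : (fun _ => _) = (fun t => tnth (f t) (Ordinal ni))).
    exact: (measurableT_comp (measurable_tnth (Ordinal ni)) mf).
  by apply/funext => t; rewrite (tnth_nth 0).
rewrite (_ : (fun _ => _) = cst 0) //.
by apply/funext => t; rewrite nth_default// size_tuple.
Qed.

Lemma chain_density_ge0 N M (s0 : R) s (r : R) e b a x :
  0 <= chain_density N M s0 s r e b a x.
Proof.
apply: mulr_ge0; first exact: root_density_ge0.
by apply: prodr_ge0 => j _; exact: edge_density_ge0.
Qed.

Lemma measurable_chain_density N M (s0 : R) s (r : R) e b disp (T : measurableType disp)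
    (a x : T -> nat -> R) :
  (forall i, measurable_fun setT (fun t => a t i)) ->
  (forall i, measurable_fun setT (fun t => x t i)) ->
  measurable_fun setT (fun t => chain_density N M s0 s r e b (a t) (x t)).
Proof.
move=> ma mx; apply: measurable_funM; first exact: measurable_root_density.
by apply: measurable_prod => j _; exact: measurable_edge_density.
Qed.

(** The indicators of the factors put together: the density is supported by the
    cone, since positivity spreads from the root along the edges. *)
Lemma chain_density_neq0 N M (s0 : R) s (r : R) e b a x :
  (M <= N)%N -> chain_density N M s0 s r e b a x != 0 ->
  (forall i, (i <= N)%N -> 0 < a i) /\
  (forall j, (j < N)%N -> 0 < a j * a j.+1 - x j ^+ 2).
Proof.
move=> MN; rewrite mulf_eq0 negb_or => /andP[r0 p0].
have aM : 0 < a M.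
  by move: r0; rewrite /root_density; case: ltP => //; rewrite mul0r eqxx.
have edge j : (j < N)%N -> 0 < a (edge_parent M j) /\
    0 < a (edge_child M j) * a (edge_parent M j) - x j ^+ 2.
  move=> jN; apply/andP; apply: contraNT p0 => H.
  rewrite (big_cat_nat (n := j)) ?(ltnW jN)//= (big_ltn jN).
  by rewrite edge_density_eq0// mul0r mulr0.
split=> [i iN|j jN]; last first.
  have [_] := edge j jN; rewrite /edge_child /edge_parent.
  by case: ifP => //; rewrite mulrC.
have chpos j : (j < N)%N -> 0 < a (edge_child M j).
  move=> /edge[p q]; rewrite -(pmulr_lgt0 _ p).
  by apply: lt_le_trans q _; rewrite gerBl sqr_ge0.
case: (ltngtP i M) => [iM|Mi|->//].
  by have := chpos i (leq_trans iM MN); rewrite /edge_child iM.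
case: i iN Mi => // i iN Mi; have := chpos i iN.
by rewrite /edge_child ltnNge -ltnS Mi.
Qed.

Lemma chain_density_cons N M (s0 : R) s (r : R) e b (a : R) (t : seq R) (x : R) (u : seq R) :
  chain_density N.+1 M.+1 s0 s r e b (nth 0 (a :: t)) (nth 0 (x :: u)) =
  edge_density (s 0%N) (e 0%N) (b 0%N) (nth 0 t 0) x a *
  chain_density N M s0 (s \o S) r (e \o S) (b \o S) (nth 0 t) (nth 0 u).
Proof.
rewrite /chain_density big_nat_recl// mulrCA; congr (_ * (_ * _)).
apply: eq_big_nat => j _; rewrite /= /edge_parent /edge_child ltnS.
by case: ifP.
Qed.

Lemma chain_density0 N (s0 : R) s (r : R) e b (a : R) (t u : seq R) :
  chain_density N 0 s0 s r e b (nth 0 (a :: t)) (nth 0 u) =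
  root_density s0 r a * \prod_(0 <= j < N) edge_density (s j) (e j) (b j)
    (nth 0 (a :: t) j) (nth 0 u j) (nth 0 t j).
Proof. by []. Qed.

(** The chain is integrated vertex after vertex, hence with the edge as the inner
    variable. *)
Lemma integral_edge_density_swap (s : R) : 1 / 2 < s -> exists2 C : R, 0 < C &
  forall d (b : R) a, 0 < d -> 0 < a ->
    (\int[leb]_c \int[leb]_x (edge_density s d b a x c)%:E = (C * d `^ (- s))%:E)%E.
Proof.
move=> s2; have [C C0 CE] := integral_edge_density s2.
exists C; [exact: C0|move=> d b a d0 a0; rewrite -[RHS](CE d b a d0 a0)].
apply: (@tonelli_swap _ _ _ _ _ leb leb) => [|c x].
  apply/measurable_EFinP; apply: measurable_edge_density => //.
by rewrite lee_fin edge_density_ge0.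
Qed.

(** Rooted at the left end, the part of the chain beyond its first edge has a mass
    that does not depend on the first vertex, so that it factors out of the integral
    over the first edge and its child. *)
Lemma integral_right_chain k s : (forall j, 1 / 2 < s j) ->
  exists2 C : R, 0 < C & forall e b (a0 : R), (forall j, 0 < e j) -> 0 < a0 ->
    (\int[mu k]_t \int[mu k]_u (\prod_(0 <= j < k)
       edge_density (s j) (e j) (b j) (nth 0 (a0 :: t) j) (nth 0 u j) (nth 0 t j))%:E
     = (C * \prod_(0 <= j < k) e j `^ (- s j))%:E)%E.
Proof.
elim: k s => [|k IH] s s2.
  have int1 (f : 0.-tuple RT -> \bar R) :
      (forall t, f t = 1%E) -> (\int[mu 0%N]_t f t = 1)%E.
    move=> f1; rewrite (_ : f = cst 1%E); last exact/funext.
    by rewrite integral_lebesgue_tuple0.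
  exists 1; first exact: ltr01.
  move=> e b a0 e0 a00; rewrite [in RHS]big_nil mulr1.
  by apply: (int1) => t; apply: (int1) => u; rewrite big_nil.
have [C0 C00 C0E] := integral_edge_density_swap (s2 0%N).
have [C C1 CE] := IH (s \o S) (fun j => s2 j.+1).
exists (C0 * C); first exact: mulr_gt0.
move=> e b a0 e0 a00.
pose K a x := edge_density (s 0%N) (e 0%N) (b 0%N) a0 x a.
pose G a (t u : seq R) := \prod_(0 <= j < k)
  edge_density (s j.+1) (e j.+1) (b j.+1) (nth 0 (a :: t) j) (nth 0 u j) (nth 0 t j).
have G0 a t u : 0 <= G a t u.
  by apply: prodr_ge0 => j _; exact: edge_density_ge0.
have mnth m i : measurable_fun setT (fun t : m.-tuple RT => nth 0 (t : seq R) i).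
  exact: measurable_nth_tuple.
have mP disp (T : measurableType disp) m (f : T -> R) (g h : T -> m.-tuple RT) :
    measurable_fun setT f -> measurable_fun setT g -> measurable_fun setT h ->
    measurable_fun setT (fun z => G (f z) (g z) (h z)).
  move=> mf mg mh; apply: measurable_prod => j _; apply: measurable_edge_density.
  - by case: j => [|j] //=; exact: measurable_nth_tuple.
  - exact: measurable_nth_tuple.
  - exact: measurable_nth_tuple.
have mGu a : measurable_fun setT (fun t : k.-tuple RT => \int[mu k]_u (G a t u)%:E)%E.
  apply: (@measurable_integral2 _ _ _ _ _ (mu k)) => [|t u]; last by rewrite lee_fin.
  by apply/measurable_EFinP; exact: mP.
have mK : measurable_fun setT (fun z : RT * RT => K z.1 z.2).
  exact: measurable_edge_density.
have mK1 a : measurable_fun setT (K a).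
  exact: measurable_edge_density.
have K0 a x : 0 <= K a x by exact: edge_density_ge0.
transitivity (\int[leb]_a \int[mu k]_t \int[leb]_x \int[mu k]_u
   ((K a x)%:E * (G a t u)%:E))%E.
  rewrite integral_lebesgue_tupleS.
  - apply: eq_integral => a _; apply: eq_integral => t _.
    rewrite integral_lebesgue_tupleS.
    + apply: eq_integral => x _; apply: eq_integral => u _.
      by rewrite -EFinM big_nat_recl.
    + apply/measurable_EFinP; apply: measurable_prod => j _.
      by apply: measurable_edge_density => //; exact: measurable_nth_tuple.
    + move=> u; rewrite lee_fin; apply: prodr_ge0 => j _.
      exact: edge_density_ge0.
  - apply: (@measurable_integral2 _ _ _ _ _ (mu k.+1)) => [|t u].
      apply/measurable_EFinP; apply: measurable_prod => j _.
      apply: measurable_edge_density; try exact: measurable_nth_tuple.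
      case: j => [|j] /=; first exact: measurable_cst.
      exact: measurable_nth_tuple.
    rewrite lee_fin; apply: prodr_ge0 => j _; exact: edge_density_ge0.
  - move=> t; apply: integral_ge0 => u _.
    rewrite lee_fin; apply: prodr_ge0 => j _; exact: edge_density_ge0.
pose P := \prod_(0 <= j < k) (e \o S) j `^ (- (s \o S) j).
have P0 : 0 <= P by apply: prodr_ge0 => j _; exact: powR_ge0.
transitivity (\int[leb]_a ((\int[leb]_x (K a x)%:E) * (C * P)%:E))%E.
  apply: eq_integral => a _; have [a1|a1] := ltP 0 a; last first.
    have K00 x : K a x = 0.
      apply: edge_density_eq0; rewrite negb_and; apply/orP; right.
      rewrite -leNgt subr_le0; apply: le_trans (sqr_ge0 x).
      exact: mulr_le0_ge0 a1 (ltW a00).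
    rewrite [in RHS]integral0_eq ?mul0e => [|x _]; last by rewrite K00.
    rewrite integral0_eq// => t _; rewrite integral0_eq// => x _.
    by rewrite integral0_eq// => u _; rewrite K00 mul0e.
  rewrite -(CE (e \o S) (b \o S) a (fun j => e0 j.+1) a1).
  rewrite -ge0_integralZl//; last 2 first.
    - by move=> t _; apply: integral_ge0 => u _; rewrite lee_fin G0.
    - by apply: integral_ge0 => x _; rewrite lee_fin.
  apply: eq_integral => t _.
  under eq_integral => x _.
    rewrite ge0_integralZl//; last 3 first.
    - by apply/measurable_EFinP; exact: mP.
    - by move=> u _; rewrite lee_fin.
    - by rewrite lee_fin.
    over.
  rewrite ge0_integralZr//.
  - by apply/measurable_EFinP; exact: mK1.
  - by move=> x _; rewrite lee_fin.
  - by apply: integral_ge0 => u _; rewrite lee_fin.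
  exact: mGu.
rewrite ge0_integralZr//.
- by rewrite C0E// -EFinM big_nat_recl//= mulrACA.
- apply: (@measurable_integral2 _ _ _ _ _ leb) => [|a x]; last by rewrite lee_fin.
  exact/measurable_EFinP.
- by move=> a _; apply: integral_ge0 => x _; rewrite lee_fin.
- by rewrite lee_fin mulr_ge0// ltW.
Qed.

(** The vertices before the root are leaves one after the other: integrating out
    the first vertex and the first edge leaves the chain on the tail, until the
    root comes first. *)
Lemma integral_chain_density N M (s0 : R) s : (M <= N)%N -> 0 < s0 ->
  (forall j, 1 / 2 < s j) ->
  exists2 C : R, 0 < C & forall r e b, 0 < r -> (forall j, 0 < e j) ->
    (\int[mu N.+1]_t \int[mu N]_u (chain_density N M s0 s r e b
        (nth 0 (t : seq R)) (nth 0 (u : seq R)))%:E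
     = (C * (r `^ (- s0) * \prod_(0 <= j < N) e j `^ (- s j)))%:E)%E.
Proof.
move=> MN s00; elim: M N MN s => [|M IH] N MN s s2.
  have [C0 C00 C0E] := integral_root_density s00.
  have [C C1 CE] := integral_right_chain N s2.
  exists (C0 * C) => [|r e b r0 e0]; first exact: mulr_gt0.
  pose P := \prod_(0 <= j < N) e j `^ (- s j).
  have P0 : 0 <= P by apply: prodr_ge0 => j _; exact: powR_ge0.
  rewrite integral_lebesgue_tupleS; first last.
  - by move=> t; apply: integral_ge0 => u _; rewrite lee_fin chain_density_ge0.
  - apply: (@measurable_integral2 _ _ _ _ _ (mu N)) => [|t u].
      apply/measurable_EFinP; apply: measurable_chain_density => i;
        exact: measurable_nth_tuple.
    by rewrite lee_fin chain_density_ge0.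
  transitivity (\int[leb]_a ((root_density s0 r a)%:E * (C * P)%:E))%E.
    apply: eq_integral => a _; have [a1|a1] := ltP 0 a; last first.
      have R0 : root_density s0 r a = 0 by rewrite /root_density ltNge a1 mul0r.
      rewrite R0 mul0e integral0_eq// => t _; rewrite integral0_eq// => u _.
      by rewrite chain_density0 R0 mul0r.
    have pr0 t u : 0 <= \prod_(0 <= j < N) edge_density (s j) (e j) (b j)
        (nth 0 (a :: t) j) (nth 0 u j) (nth 0 t j).
      by apply: prodr_ge0 => j _; exact: edge_density_ge0.
    have mpr disp (T : measurableType disp) (f g : T -> N.-tuple RT) :
      measurable_fun setT f -> measurable_fun setT g ->
      measurable_fun setT (fun z : T => \prod_(0 <= j < N)
         edge_density (s j) (e j) (b j)
        (nth 0 (a :: f z) j) (nth 0 (g z : seq R) j) (nth 0 (f z : seq R) j)).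
      move=> mf mg; apply: measurable_prod => j _; apply: measurable_edge_density.
      - by case: j => [|j] //=; exact: measurable_nth_tuple.
      - exact: measurable_nth_tuple.
      - exact: measurable_nth_tuple.
    rewrite -(CE e b a e0 a1) -ge0_integralZl//; last 3 first.
    - apply: (@measurable_integral2 _ _ _ _ _ (mu N)) => [|t u].
        by apply/measurable_EFinP; exact: mpr.
      by rewrite lee_fin pr0.
    - by move=> t _; apply: integral_ge0 => u _; rewrite lee_fin pr0.
    - by rewrite lee_fin root_density_ge0.
    apply: eq_integral => t _; rewrite -ge0_integralZl//.
    - by apply/measurable_EFinP; exact: mpr.
    - by move=> u _; rewrite lee_fin pr0.
    - by rewrite lee_fin root_density_ge0.
  rewrite ge0_integralZr//.
  - by rewrite C0E// -EFinM mulrACA.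
  - by apply/measurable_EFinP; exact: measurable_root_density.
  - by move=> a _; rewrite lee_fin root_density_ge0.
  - by rewrite lee_fin mulr_ge0// ltW.
case: N MN => // N MN.
have [C0 C00 C0E] := integral_edge_density_swap (s2 0%N).
have [C C1 CE] := IH N MN (s \o S) (fun j => s2 j.+1).
exists (C0 * C) => [|r e b r0 e0]; first exact: mulr_gt0.
pose K (t : seq R) a x := edge_density (s 0%N) (e 0%N) (b 0%N) (nth 0 t 0) x a.
pose G (t u : seq R) :=
  chain_density N M s0 (s \o S) r (e \o S) (b \o S) (nth 0 t) (nth 0 u).
have K0 t a x : 0 <= K t a x by exact: edge_density_ge0.
have G0 t u : 0 <= G t u by exact: chain_density_ge0.
have mG disp (T : measurableType disp) m n (f : T -> m.-tuple RT)
   (g : T -> n.-tuple RT) : measurable_fun setT f -> measurable_fun setT g ->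
   measurable_fun setT (fun z => G (f z) (g z)).
  by move=> mf mg; apply: measurable_chain_density => i; exact: measurable_nth_tuple.
have mK disp (T : measurableType disp) m (f : T -> m.-tuple RT) (g h : T -> R) :
   measurable_fun setT f -> measurable_fun setT g -> measurable_fun setT h ->
   measurable_fun setT (fun z => K (f z) (g z) (h z)).
  by move=> mf mg mh; apply: measurable_edge_density => //; exact: measurable_nth_tuple.
have mGu : measurable_fun setT (fun t : N.+1.-tuple RT => \int[mu N]_u (G t u)%:E)%E.
  apply: (@measurable_integral2 _ _ _ _ _ (mu N)) => [|t u]; last by rewrite lee_fin.
  by apply/measurable_EFinP; exact: mG.
have mKx disp (T : measurableType disp) m (f : T -> m.-tuple RT) (g : T -> R) :
    measurable_fun setT f -> measurable_fun setT g ->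
    measurable_fun setT (fun z => \int[leb]_x (K (f z) (g z) x)%:E)%E.
  move=> mf mg.
  apply: (@measurable_integral2 _ _ _ _ _ leb) => [|z x]; last by rewrite lee_fin.
  apply/measurable_EFinP; apply: mK => //; exact: measurableT_comp.
transitivity (\int[leb]_a \int[mu N.+1]_t
  ((\int[mu N]_u (G t u)%:E) * (\int[leb]_x (K t a x)%:E)))%E.
  rewrite integral_lebesgue_tupleS; first last.
  - by move=> t; apply: integral_ge0 => u _; rewrite lee_fin chain_density_ge0.
  - apply: (@measurable_integral2 _ _ _ _ _ (mu N.+1)) => [|t u].
      apply/measurable_EFinP; apply: measurable_chain_density => i;
        exact: measurable_nth_tuple.
    by rewrite lee_fin chain_density_ge0.
  apply: eq_integral => a _; apply: eq_integral => t _.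
  rewrite integral_lebesgue_tupleS; first last.
  - by move=> u; rewrite lee_fin chain_density_ge0.
  - apply/measurable_EFinP; apply: measurable_chain_density => i.
      exact: measurable_cst.
    exact: measurable_nth_tuple.
  rewrite -ge0_integralZl//; first last.
  - by apply: integral_ge0 => u _; rewrite lee_fin.
  - by move=> x _; rewrite lee_fin.
  - by apply/measurable_EFinP; exact: mK.
  apply: eq_integral => x _.
  rewrite -ge0_integralZr//; first last.
  - by rewrite lee_fin.
  - by move=> u _; rewrite lee_fin.
  - by apply/measurable_EFinP; exact: mG.
  by apply: eq_integral => u _; rewrite chain_density_cons EFinM muleC.
rewrite tonelli_swap; first last.
- by move=> a t; apply: mule_ge0; apply: integral_ge0 => ? _; rewrite lee_fin.
- by apply: emeasurable_funM; [exact: measurableT_comp mGu _|exact: mKx].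
pose P := C0 * e 0%N `^ (- s 0%N).
have P0 : 0 <= P by rewrite mulr_ge0 ?powR_ge0// ltW.
transitivity (\int[mu N.+1]_t ((\int[mu N]_u (G t u)%:E) * P%:E))%E.
  apply: eq_integral => t _.
  rewrite ge0_integralZl//; first last.
  - by apply: integral_ge0 => u _; rewrite lee_fin.
  - by move=> a _; apply: integral_ge0 => x _; rewrite lee_fin.
  - exact: mKx.
  have [t0|t0] := ltP 0 (nth 0 (t : seq R) 0); first by rewrite C0E.
  have -> : (\int[mu N]_u (G t u)%:E = 0)%E; last by rewrite !mul0e.
  apply: integral0_eq => u _.
  have [->//|/chain_density_neq0 -/(_ MN)[/(_ 0%N isT)]] := eqVneq (G t u) 0.
  by rewrite ltNge t0.
rewrite ge0_integralZr//.
- rewrite (CE r (e \o S) (b \o S) r0 (fun j => e0 j.+1)) -EFinM [in RHS]big_nat_recl//= /P; congr EFin; ring.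
- by move=> t _; apply: integral_ge0 => u _; rewrite lee_fin.
Qed.

End chain_density.

(** * Tridiagonal forms and their elimination towards the root *)

Section chain_form.
Context {R : realType}.
Implicit Types (p q e b a x v : nat -> R) (r : R) (N M : nat).

(** Induction from the root outwards: any other vertex is the child of an edge. *)
Lemma outward_ind N M (P : nat -> Prop) : (M <= N)%N -> P M ->
  (forall j, (j < N)%N -> P (edge_parent M j) -> P (edge_child M j)) ->
  forall i, (i <= N)%N -> P i.
Proof.
move=> MN PM H i iN; case: (leqP M i) => [|/ltnW] Mi.
  rewrite -(subnKC Mi); have : (M + (i - M) <= N)%N by rewrite subnKC.
  elim: (i - M)%N => [|k IH] kN; first by rewrite addn0.
  rewrite addnS in kN *.
  have /= := H (M + k)%N kN; rewrite /edge_parent /edge_child ltnNge leq_addr /=.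
  by apply; apply: IH; exact: ltnW.
rewrite -(subKn Mi); elim: (M - i)%N (leq_subr i M) => [|k IH] kM; first by rewrite subn0.
have lt : (M - k.+1 < M)%N by rewrite ltn_subrL /= (leq_trans _ kM).
have := H (M - k.+1)%N (leq_trans lt MN); rewrite /edge_parent /edge_child lt.
by rewrite subnSK//; apply; apply: IH; exact: ltnW.
Qed.

Definition tridiag_form N p q a x : R :=
  \sum_(0 <= i < N.+1) p i * a i + 2 * \sum_(0 <= j < N) q j * x j.

Definition edge_form (b a x c : R) : R := c + 2 * b * x + b ^+ 2 * a.

Definition chain_form N M r e b a x : R :=
  r * a M + \sum_(0 <= j < N)
    e j * edge_form (b j) (a (edge_parent M j)) (x j) (a (edge_child M j)).

(** With [sqv] and [mulv], a tridiagonal form evaluated at the rank one matrix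
    [v v^T] is a quadratic form in [v]. *)
Definition sqv v : nat -> R := fun i => v i ^+ 2.
Definition mulv v : nat -> R := fun i => v i * v i.+1.

Definition tridiag_posdef N p q := forall v,
  (exists2 i, (i <= N)%N & v i != 0) -> 0 < tridiag_form N p q (sqv v) (mulv v).

Lemma edge_form_sqr (b : R) M v j :
  edge_form b (sqv v (edge_parent M j)) (mulv v j) (sqv v (edge_child M j)) =
  (v (edge_child M j) + b * v (edge_parent M j)) ^+ 2.
Proof.
rewrite /edge_form /sqv /mulv /edge_parent /edge_child.
by case: ifP => _; ring.
Qed.

(** The difference of the two sides is [(a * c - x ^+ 2) / a]. *)
Lemma edge_form_ge (b a x c : R) : 0 < a -> 0 < a * c - x ^+ 2 ->
  (x + b * a) ^+ 2 / a <= edge_form b a x c.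
Proof.
move=> a0 d0; rewrite -subr_ge0 /edge_form.
have -> : c + 2 * b * x + b ^+ 2 * a - (x + b * a) ^+ 2 / a = (a * c - x ^+ 2) / a.
  by field; rewrite gt_eqF.
by rewrite divr_ge0// ltW.
Qed.

Lemma edge_form_ge0 (b a x c : R) : 0 < a -> 0 < a * c - x ^+ 2 ->
  0 <= edge_form b a x c.
Proof.
move=> a0 d0; apply: le_trans (edge_form_ge b a0 d0).
by rewrite divr_ge0 ?sqr_ge0// ltW.
Qed.

Definition chain_cone N a x := (forall i, (i <= N)%N -> 0 < a i) /\
  (forall j, (j < N)%N -> 0 < a j * a j.+1 - x j ^+ 2).

Lemma chain_cone_edge N M a x j : chain_cone N a x -> (j < N)%N ->
  0 < a (edge_parent M j) /\
  0 < a (edge_parent M j) * a (edge_child M j) - x j ^+ 2.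
Proof.
move=> [a0 d0] jN; rewrite /edge_parent /edge_child.
case: ifP => _; split; [exact: a0|by rewrite mulrC d0| |exact: d0].
exact/a0/ltnW.
Qed.

Lemma chain_form_ge0 N M r e b a x : (M <= N)%N -> 0 < r ->
  (forall j, 0 < e j) -> chain_cone N a x -> 0 <= chain_form N M r e b a x.
Proof.
move=> MN r0 e0 ax; apply: addr_ge0; first by rewrite mulr_ge0 ?ltW//; exact: ax.1.
rewrite big_nat; apply: sumr_ge0 => j jN; rewrite mulr_ge0 ?(ltW (e0 j))//.
by have [? ?] := chain_cone_edge M ax jN; exact: edge_form_ge0.
Qed.

(** A sum of squares; if it vanishes, so does [v] at the root, and then along every
    edge from the parent to the child. *)
Lemma chain_form_posdef N M r e b v : (M <= N)%N -> 0 < r ->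
  (forall j, 0 < e j) -> (exists2 i, (i <= N)%N & v i != 0) ->
  0 < chain_form N M r e b (sqv v) (mulv v).
Proof.
move=> MN r0 e0 [i0 i0N vi0].
have t0 j : 0 <= e j * edge_form (b j) (sqv v (edge_parent M j)) (mulv v j)
    (sqv v (edge_child M j)).
  by rewrite edge_form_sqr mulr_ge0 ?sqr_ge0 ?(ltW (e0 j)).
have rt0 : 0 <= r * sqv v M by rewrite mulr_ge0 ?sqr_ge0 ?ltW.
rewrite lt_neqAle; apply/andP; split; last by rewrite addr_ge0// sumr_ge0.
apply: contra vi0; rewrite eq_sym paddr_eq0//; last exact: sumr_ge0.
rewrite mulf_eq0 gt_eqF//= sqrf_eq0 psumr_eq0// => /andP[/eqP vM /allP sum0].
apply/eqP; move: i0 i0N; apply: (outward_ind MN vM) => j jN vp.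
have := sum0 j; rewrite mem_index_iota jN => /(_ isT) /=.
rewrite edge_form_sqr mulf_eq0 gt_eqF//= sqrf_eq0 vp mulr0 addr0.
by move/eqP.
Qed.

Lemma tridiag_formS N p q a x : tridiag_form N.+1 p q a x =
  p 0%N * a 0%N + 2 * (q 0%N * x 0%N) +
  tridiag_form N (p \o S) (q \o S) (a \o S) (x \o S).
Proof. by rewrite /tridiag_form !(big_nat_recl _ 0)//=; ring. Qed.

Lemma chain_formSS N M r e b a x : chain_form N.+1 M.+1 r e b a x =
  e 0%N * edge_form (b 0%N) (a 1%N) (x 0%N) (a 0%N) +
  chain_form N M r (e \o S) (b \o S) (a \o S) (x \o S).
Proof.
rewrite /chain_form big_nat_recl//= addrCA; congr (_ + (_ + _)).
apply: eq_big_nat => j _; rewrite /edge_parent /edge_child /= ltnS.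
by case: ifP.
Qed.

Lemma chain_formS0 N r e b a x : chain_form N.+1 0 r e b a x =
  r * a 0%N + e 0%N * (2 * b 0%N * x 0%N + b 0%N ^+ 2 * a 0%N) +
  chain_form N 0 (e 0%N) (e \o S) (b \o S) (a \o S) (x \o S).
Proof.
by rewrite /chain_form big_nat_recl//= /edge_form /edge_parent /edge_child /=; ring.
Qed.

Let consn (y : R) (f : nat -> R) i := if i is j.+1 then f j else y.

(** The tail is eliminated first, by induction.  Positivity of the root parameter
    is read off at the vector that makes every square of an edge vanish. *)
Lemma tridiag_elim0 N p q : tridiag_posdef N p q ->
  exists r e b, [/\ 0 < r, (forall j, 0 < e j) &
    forall a x, tridiag_form N p q a x = chain_form N 0 r e b a x].
Proof.
elim: N p q => [|N IH] p q pd.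
  exists (p 0%N), (fun=> 1), (fun=> 0); split=> // [|a x].
    have := pd (fun=> 1); rewrite /tridiag_form !big_nat1 big_nil /sqv expr1n mulr1.
    by rewrite mulr0 addr0; apply; exists 0%N => //; exact: oner_neq0.
  by rewrite /tridiag_form /chain_form big_nat1 !big_nil mulr0.
have pd' : tridiag_posdef N (p \o S) (q \o S).
  move=> v [i iN vi]; have := pd (consn 0 v).
  rewrite tridiag_formS /sqv /mulv /= expr0n /= !(mul0r,mulr0,add0r).
  by apply; exists i.+1.
have [r' [e' [b' [r'0 e'0 E]]]] := IH _ _ pd'.
pose e := consn r' e'; pose b := consn (q 0%N / r') b'.
pose r := p 0%N - q 0%N ^+ 2 / r'.
have E' a x : tridiag_form N.+1 p q a x = chain_form N.+1 0 r e b a x.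
  rewrite tridiag_formS chain_formS0 E /=; congr (_ + _).
  by rewrite /r; field; rewrite gt_eqF.
exists r, e, b; split => //; last by case.
pose v := fix v i := if i is j.+1 then - b j * v j else 1.
have := pd v; rewrite E' /chain_form big1 => [|j _]; last first.
  by rewrite edge_form_sqr /edge_child /edge_parent /= mulNr addNr expr0n mulr0.
rewrite addr0 /sqv /= expr1n mulr1; apply.
by exists 0%N => //=; exact: oner_neq0.
Qed.

(** Cholesky elimination: the first vertex, when it is not the root, is a leaf; its
    elimination replaces the diagonal entry of its neighbour by a Schur
    complement. *)
Lemma tridiag_elim N M p q : (M <= N)%N -> tridiag_posdef N p q ->
  exists r e b, [/\ 0 < r, (forall j, 0 < e j) &
    forall a x, tridiag_form N p q a x = chain_form N M r e b a x].
Proof.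
elim: M N p q => [|M IH] N p q MN pd; first exact: tridiag_elim0.
case: N MN pd => // N MN pd.
have p0 : 0 < p 0%N.
  have := pd (fun i => (i == 0%N)%:R).
  rewrite tridiag_formS /tridiag_form /sqv /mulv !big1 => [|j _|j _]; first last.
  - by rewrite /= expr0n mulr0.
  - by rewrite /= mulr0 mulr0.
  rewrite /= !(mulr0,addr0,expr1n,mulr1).
  by apply; exists 0%N => //=; exact: oner_neq0.
pose b0 := q 0%N / p 0%N.
pose p' := consn (p 1%N - q 0%N ^+ 2 / p 0%N) (p \o S \o S).
have T a x : tridiag_form N (p \o S) (q \o S) a x =
    tridiag_form N p' (q \o S) a x + q 0%N ^+ 2 / p 0%N * a 0%N.
  rewrite /tridiag_form !(big_nat_recl _ 0)//=; ring.
have pd' : tridiag_posdef N p' (q \o S).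
  move=> v [i iN vi]; have := pd (consn (- b0 * v 0%N) v).
  rewrite tridiag_formS T -[sqv _ \o S]/(sqv v) -[mulv _ \o S]/(mulv v) => H.
  have {}H := H (ex_intro2 _ _ i.+1 iN vi).
  apply: (lt_le_trans H); rewrite le_eqVlt; apply/orP; left; apply/eqP.
  by rewrite /b0 /sqv /mulv /=; field; rewrite gt_eqF.
have [r [e [b [r0 e0 E]]]] := IH _ _ _ MN pd'.
exists r, (consn (p 0%N) e), (consn b0 b); split => // [|a x]; first by case.
rewrite chain_formSS tridiag_formS T E /= /edge_form.
rewrite -[consn _ e \o S]/e -[consn _ b \o S]/b.
by rewrite /b0; field; rewrite gt_eqF.
Qed.

Lemma chain_form_tridiag N M r e b : (M <= N)%N -> exists p q, forall a x,
  tridiag_form N p q a x = chain_form N M r e b a x.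
Proof.
move=> MN.
have pick c a : (c <= N)%N -> \sum_(0 <= i < N.+1) (c == i)%:R * a i = a c :> R.
  move=> cN; rewrite (bigD1_seq c) ?iota_uniq ?mem_index_iota//= eqxx mul1r.
  rewrite big1 ?addr0// => i; rewrite eq_sym => /negbTE ->; exact: mul0r.
exists (fun i => r * (M == i)%:R + \sum_(0 <= j < N)
   (e j * (edge_child M j == i)%:R + e j * b j ^+ 2 * (edge_parent M j == i)%:R)),
  (fun j => e j * b j) => a x.
rewrite /tridiag_form /chain_form.
under eq_bigr do rewrite mulrDl -mulrA.
rewrite big_split /= -big_distrr /= pick// -addrA; congr (_ + _).
under eq_bigr do rewrite mulr_suml.
rewrite exchange_big /= mulr_sumr -big_split /=.
apply: eq_big_nat => j /andP[_ jN].
under eq_bigr do rewrite mulrDl -!mulrA.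
rewrite big_split /= -!big_distrr /= !pick; last 2 first.
- exact: leq_edge_parent.
- exact: leq_edge_child.
by rewrite /edge_form; ring.
Qed.

End chain_form.

(** * Tridiagonal matrices and the linear forms they define *)

Section tridiagonal_matrices.
Context {R : realType}.
Implicit Types (p q a x v : nat -> R) (N M : nat).

Definition tridiag_mx N p q : 'M[R]_N.+1 :=
  \matrix_(i, j) if i == j then p i
                 else if j == i.+1 :> nat then q i
                 else if i == j.+1 :> nat then q j else 0.

Lemma tridiag_mx_ZG N p q : ZG (tridiag_mx N p q).
Proof.
split; first apply/matrixP => i j.
  rewrite !mxE eq_sym; case: eqP => [->//|_].
  by case: eqP => [ji|_]; case: eqP => [ij|_] //; lia.
move=> i j; rewrite /path_edge mxE => ij.
case: eqP => [ji|_]; first by subst; lia.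
by case: eqP => [ji|_]; [lia|case: eqP => [ji|//]; lia].
Qed.

Lemma ZG_tridiag_mx N (y : 'M[R]_N.+1) : ZG y ->
  y = tridiag_mx N (fun i => y (inord i) (inord i)) (fun i => y (inord i) (inord i.+1)).
Proof.
move=> [ysym yz]; apply/matrixP => i j; rewrite mxE.
case: eqP => [->|ij]; first by rewrite inord_val.
case: eqP => [ji|ji]; first by rewrite -ji !inord_val.
case: eqP => [ij'|ij']; first by rewrite -ij' !inord_val -[in LHS]ysym mxE.
apply: yz; rewrite /path_edge; apply/negP => adj; case: ij; apply: val_inj => /=; lia.
Qed.

Lemma sum_tridiag N (f : nat -> nat -> R) : (forall i j, f i j = f j i) ->
  (forall i j, (i.+1 < j)%N -> f i j = 0) ->
  \sum_(0 <= i < N.+1) \sum_(0 <= j < N.+1) f i j =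
  \sum_(0 <= i < N.+1) f i i + 2 * \sum_(0 <= j < N) f j j.+1.
Proof.
move=> fC f0; elim: N => [|N IH]; first by rewrite !big_nat1 big_nil mulr0 addr0.
have last : \sum_(0 <= i < N.+1) f i N.+1 = f N N.+1.
  rewrite big_nat_recr//= big_nat big1 ?add0r// => i iN; exact: f0.
rewrite big_nat_recr//=; under eq_bigr do rewrite big_nat_recr//=.
rewrite big_split/= IH last [in X in _ + X]big_nat_recr//=.
under [X in _ + (X + _)]eq_bigr do rewrite fC.
rewrite last [in RHS]big_nat_recr//= [X in _ = _ + 2 * X]big_nat_recr//=.
by ring.
Qed.

Lemma sum_tridiag_mx N p q (w : nat -> nat -> R) : (forall i j, w i j = w j i) ->
  \sum_(i < N.+1) \sum_(j < N.+1) tridiag_mx N p q i j * w i j =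
  tridiag_form N p q (fun i => w i i) (fun j => w j j.+1).
Proof.
move=> wC.
pose c i j := if i == j then p i else if j == i.+1 then q i
              else if i == j.+1 then q j else 0.
have cC i j : c i j = c j i.
  rewrite /c eq_sym; case: eqP => [->//|_].
  by case: eqP => [ji|_]; case: eqP => [ij|_] //; lia.
transitivity (\sum_(0 <= i < N.+1) \sum_(0 <= j < N.+1) c i j * w i j).
  rewrite big_mkord; apply: eq_bigr => i _; rewrite big_mkord.
  by apply: eq_bigr => j _; rewrite mxE.
rewrite sum_tridiag => [||i j ij]; last 2 first.
- by move=> i j; rewrite cC wC.
- by rewrite /c; do 3 (case: eqP => [e|_]; first lia); rewrite mul0r.
rewrite /tridiag_form; congr (_ + 2 * _); apply: eq_bigr => i _.
  by rewrite /c eqxx.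
by rewrite /c eqn_leq ltnn andbF eqxx.
Qed.

Lemma IGmx_tridiag N (eta : @IG R N.+1) :
  IGmx eta = tridiag_mx N (nth 0 (eta.1 : seq R)) (nth 0 (eta.2 : seq R)).
Proof. by apply/matrixP => i j; rewrite !mxE (tnth_nth 0). Qed.

Lemma pairing_tridiag N p q (eta : @IG R N.+1) :
  pairing (tridiag_mx N p q) eta =
  tridiag_form N p q (nth 0 (eta.1 : seq R)) (nth 0 (eta.2 : seq R)).
Proof.
pose w i j : R := if i == j then (eta.1 : seq R)`_i else if j == i.+1 then (eta.2 : seq R)`_i
              else if i == j.+1 then (eta.2 : seq R)`_j else 0.
have wC i j : w i j = w j i.
  rewrite /w eq_sym; case: eqP => [->//|_].
  by case: eqP => [ji|_]; case: eqP => [ij|_] //; lia.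
transitivity (\sum_(i < N.+1) \sum_(j < N.+1) tridiag_mx N p q i j * w i j).
  apply: eq_bigr => i _; rewrite big_mkcond; apply: eq_bigr => j _.
  rewrite IGmx_tridiag; case: ifPn => [_|/(tridiag_mx_ZG N p q).2 ->]; first by rewrite !mxE.
  by rewrite mul0r.
rewrite sum_tridiag_mx//; congr tridiag_form; apply/funext => i; rewrite /w ?eqxx//.
by rewrite (_ : (i == i.+1) = false)//; lia.
Qed.

Lemma quadratic_tridiag N p q (v : 'cV[R]_N.+1) :
  (v^T *m tridiag_mx N p q *m v) 0 0 =
  tridiag_form N p q (sqv (fun i => v (inord i) 0)) (mulv (fun i => v (inord i) 0)).
Proof.
rewrite mxE; under eq_bigr do rewrite mxE mulr_suml.
rewrite exchange_big/=.
rewrite -(@sum_tridiag_mx _ _ _ (fun i j => v (inord i) 0 * v (inord j) 0)).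
  apply: eq_bigr => i _; apply: eq_bigr => j _.
  by rewrite !inord_val [v^T _ _]mxE mulrAC mulrC.
by move=> i j; rewrite mulrC.
Qed.

Lemma PG_tridiag N p q : PG (tridiag_mx N p q) <-> tridiag_posdef N p q.
Proof.
split=> [[_ pd] v [i iN vi]|pd].
  pose w : 'cV[R]_N.+1 := \col_i v i.
  have /pd : w != 0.
    apply: contra vi => /eqP/matrixP/(_ (inord i) 0).
    by rewrite !mxE inordK// => ->.
  rewrite quadratic_tridiag.
  rewrite (_ : tridiag_form _ _ _ _ _ = tridiag_form N p q (sqv v) (mulv v))//.
  rewrite /tridiag_form; congr (_ + 2 * _); apply: eq_big_nat => j /andP[_ jN].
    by rewrite /sqv mxE inordK.
  by rewrite /mulv !mxE !inordK// ltnW.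
split; first exact: tridiag_mx_ZG.
move=> v v0; rewrite quadratic_tridiag; apply: pd.
have [i vi] : exists i, v i 0 != 0.
  apply: contrapT => H; case/eqP : v0; apply/matrixP => i j; rewrite mxE ord1.
  by apply/eqP/negPn/negP => ?; apply: H; exists i.
by exists i; [rewrite -ltnS|rewrite inord_val].
Qed.

Lemma tridiag_form_inj N p q p' q' :
  (forall a x, tridiag_form N p q a x = tridiag_form N p' q' a x) ->
  tridiag_mx N p q = tridiag_mx N p' q'.
Proof.
move=> E.
have pE i : (i <= N)%N -> p i = p' i.
  move=> iN; have := E (fun k => (k == i)%:R) (fun=> 0).
  have H (f : nat -> R) : tridiag_form N f q (fun k => (k == i)%:R) (fun=> 0) = f i.
    rewrite /tridiag_form [X in _ + 2 * X]big1 ?mulr0 ?addr0 => [|? _]; last by rewrite mulr0.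
    rewrite (bigD1_seq i) ?iota_uniq ?mem_index_iota//= eqxx mulr1 big1 ?addr0//.
    by move=> k /negbTE ->; rewrite mulr0.
  have H' : tridiag_form N p' q' (fun k => (k == i)%:R) (fun=> 0) =
            tridiag_form N p' q (fun k => (k == i)%:R) (fun=> 0).
    by rewrite /tridiag_form; congr (_ + 2 * _); apply: eq_bigr => ? _; rewrite !mulr0.
  by rewrite H' !H.
have qE i : (i < N)%N -> q i = q' i.
  move=> iN; have := E (fun=> 0) (fun k => (k == i)%:R).
  have H (f g : nat -> R) : tridiag_form N f g (fun=> 0) (fun k => (k == i)%:R) = 2 * g i.
    rewrite /tridiag_form [X in X + _]big1 ?add0r => [|? _]; last by rewrite mulr0.
    rewrite (bigD1_seq i) ?iota_uniq ?mem_index_iota//= eqxx mulr1 big1 ?addr0//.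
    by move=> k /negbTE ->; rewrite mulr0.
  by rewrite !H => /mulfI; apply; rewrite pnatr_eq0.
apply/matrixP => i j; rewrite !mxE; case: eqP => _; first by rewrite pE// -ltnS.
case: eqP => [ji|_]; first by rewrite qE// -ltnS -ji.
by case: eqP => // ij; rewrite qE// -ltnS -ij.
Qed.

(** Matrices of [ZG] are compared through the linear forms that they define on
    incomplete matrices, where the chain parameters appear directly. *)
Definition represents N (y : 'M[R]_N.+1) (F : (nat -> R) -> (nat -> R) -> R) :=
  exists p q, y = tridiag_mx N p q /\ forall a x, tridiag_form N p q a x = F a x.

Lemma represents_inj N (y y' : 'M[R]_N.+1) F : represents y F -> represents y' F ->
  y = y'.
Proof.
move=> [p [q [-> E]]] [p' [q' [-> E']]].
by apply: tridiag_form_inj => a x; rewrite E E'.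
Qed.

Lemma eq_represents N (y : 'M[R]_N.+1) F F' :
  (forall a x, F a x = F' a x) -> represents y F -> represents y F'.
Proof. by move=> FF' [p [q [-> E]]]; exists p, q; split => // a x; rewrite E. Qed.

Lemma represents0 N : represents (0 : 'M[R]_N.+1) (fun _ _ => 0).
Proof.
exists (fun=> 0), (fun=> 0); split.
  by apply/matrixP => i j; rewrite !mxE; do 3 case: ifP => //.
by move=> a x; rewrite /tridiag_form !big1 ?mulr0 ?addr0// => *; rewrite mul0r.
Qed.

Lemma representsD N (y y' : 'M[R]_N.+1) F F' : represents y F -> represents y' F' ->
  represents (y + y') (fun a x => F a x + F' a x).
Proof.
move=> [p [q [-> E]]] [p' [q' [-> E']]].
exists (fun i => p i + p' i), (fun i => q i + q' i); split.
  apply/matrixP => i j; rewrite !mxE; do 3 case: ifP => // _; by rewrite addr0.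
move=> a x; rewrite -E -E' /tridiag_form addrACA -mulrDr -!big_split/=.
by congr (_ + 2 * _); apply: eq_bigr => i _; rewrite mulrDl.
Qed.

Lemma representsZ N (y : 'M[R]_N.+1) F c : represents y F ->
  represents (c *: y) (fun a x => c * F a x).
Proof.
move=> [p [q [-> E]]]; exists (fun i => c * p i), (fun i => c * q i); split.
  apply/matrixP => i j; rewrite !mxE; do 3 case: ifP => // _; by rewrite mulr0.
move=> a x; rewrite -E /tridiag_form mulrDr mulrCA !mulr_sumr.
by congr (_ + _); apply: eq_bigr => i _; rewrite -?mulrA// mulrCA.
Qed.

Lemma representsB N (y y' : 'M[R]_N.+1) F F' : represents y F -> represents y' F' ->
  represents (y - y') (fun a x => F a x - F' a x).
Proof.
move=> yF /(representsZ (-1)) yF'; rewrite -scaleN1r.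
by apply: eq_represents (representsD yF yF') => a x; rewrite mulN1r.
Qed.

Lemma represents_sum N m n (y : nat -> 'M[R]_N.+1) F :
  (forall k, (m <= k < n)%N -> represents (y k) (F k)) ->
  represents (\sum_(m <= k < n) y k) (fun a x => \sum_(m <= k < n) F k a x).
Proof.
move=> H; rewrite big_nat_cond.
apply: (@eq_represents _ _ (fun a x => \sum_(m <= k < n | (m <= k < n)%N && true) F k a x)).
  by move=> a x; rewrite -big_nat_cond.
elim: (index_iota m n) => [|k r IH].
  rewrite big_nil; apply: eq_represents (represents0 N) => a x; by rewrite big_nil.
rewrite big_cons; case: ifPn => kmn.
  apply: eq_represents (representsD (H k _) IH) => [a x|]; first by rewrite big_cons kmn.
  by case/andP: kmn.
by apply: eq_represents IH => a x; rewrite big_cons (negbTE kmn).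
Qed.

Lemma represents_pairing N (y : 'M[R]_N.+1) F (eta : IG N.+1) : represents y F ->
  pairing y eta = F (nth 0 (eta.1 : seq R)) (nth 0 (eta.2 : seq R)).
Proof. by move=> [p [q [-> E]]]; rewrite pairing_tridiag E. Qed.

Lemma PG_chain_form N M (y : 'M[R]_N.+1) : (M <= N)%N -> PG y ->
  exists r e b, [/\ 0 < r, (forall j, 0 < e j) & represents y (chain_form N M r e b)].
Proof.
move=> MN Py; have := Py; rewrite (ZG_tridiag_mx Py.1) => /PG_tridiag pd.
have [r [e [b [r0 e0 E]]]] := tridiag_elim MN pd.
by exists r, e, b; split => //; eexists; eexists; split; [reflexivity|].
Qed.

Lemma chain_form_PG N M (y : 'M[R]_N.+1) r e b : (M <= N)%N -> 0 < r ->
  (forall j, 0 < e j) -> represents y (chain_form N M r e b) -> PG y.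
Proof.
move=> MN r0 e0 [p [q [-> E]]]; apply/PG_tridiag => v vi.
by rewrite E; exact: chain_form_posdef.
Qed.

Lemma chain_form_represents N M r e b : (M <= N)%N ->
  exists y : 'M[R]_N.+1, represents y (chain_form N M r e b).
Proof.
by move=> /(chain_form_tridiag r e b) [p [q E]]; exists (tridiag_mx N p q), p, q.
Qed.

End tridiagonal_matrices.

(** * The dual cone *)

Section QG_cone.
Context {R : realType}.
Implicit Types (p q a x v : nat -> R) (N M : nat).

Lemma continuous_sum (T : topologicalType) (I : Type) (r : seq I) (P : pred I)
    (F : I -> T -> R) : (forall i, continuous (F i)) ->
  continuous (fun t => \sum_(i <- r | P i) F i t).
Proof.
move=> cF; elim: r => [|i r IH] t.
  rewrite (_ : (fun _ => _) = cst 0); first exact: cvg_cst.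
  by apply/funext => u; rewrite big_nil.
rewrite (_ : (fun _ => _) = fun u => (if P i then F i u else 0) + \sum_(j <- r | P j) F j u).
  apply: cvgD; last exact: IH.
  by case: (P i); [exact: cF|exact: cvg_cst].
by apply/funext => u; rewrite big_cons; case: ifP; rewrite ?add0r.
Qed.

Lemma continuous_pairing n (eta : IG n) : continuous (fun y : 'M[R]_n => pairing y eta).
Proof.
apply: continuous_sum => i; apply: continuous_sum => j y.
have /(_ y) cij := @coord_continuous R n n i j.
apply: (@continuousM R _ (fun z : 'M[R]_n => z i j) (cst (IGmx eta i j)) y cij).
exact: cst_continuous.
Qed.

(** Adding a small multiple of the identity makes the matrix positive definite. *)
Lemma closure_PG_tridiag N p q :
  (forall v, 0 <= tridiag_form N p q (sqv v) (mulv v)) ->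
  closure (@PG R N.+1) (tridiag_mx N p q).
Proof.
move=> psd B /nbhs_ballP[e e0 eB].
exists (tridiag_mx N (fun i => p i + e / 2) q); split; last first.
  apply: eB; split => // i j; rewrite !mxE.
  case: ifP => _; last by case: ifP => _; [|case: ifP => _]; exact: ballxx.
  rewrite -ball_normE /ball_/= opprD addNKr normrN ger0_norm.
    by rewrite ltr_pdivrMr// ltr_pMr// ltr1n.
  by rewrite divr_ge0// ltW.
apply/PG_tridiag => v [i iN vi].
have -> : tridiag_form N (fun i => p i + e / 2) q (sqv v) (mulv v) =
    tridiag_form N p q (sqv v) (mulv v) + \sum_(0 <= i < N.+1) e / 2 * v i ^+ 2.
  rewrite /tridiag_form addrAC -big_split/=; congr (_ + _).
  by apply: eq_bigr => k _; rewrite mulrDl.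
apply: ltr_wpDl => //.
rewrite (bigD1_seq i) ?iota_uniq ?mem_index_iota//=.
have e20 : 0 < e / 2 by rewrite divr_gt0.
apply: ltr_wpDr; last by rewrite mulr_gt0// exprn_even_gt0.
by apply: sumr_ge0 => k _; rewrite mulr_ge0 ?sqr_ge0// ltW.
Qed.

Definition coord1 N (eta : @IG R N.+1) : nat -> R := nth 0 (eta.1 : seq R).
Definition coord2 N (eta : @IG R N.+1) : nat -> R := nth 0 (eta.2 : seq R).

Lemma tridiag_form_sqv N a x v :
  tridiag_form N (sqv v) (mulv v) a x = tridiag_form N a x (sqv v) (mulv v).
Proof.
by rewrite /tridiag_form; congr (_ + 2 * _); apply: eq_bigr => i _; rewrite mulrC.
Qed.

(** For [v] supported by two consecutive vertices the rank one matrix [v v^T] is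
    tridiagonal, and the form is the square of [\sum_i v i * w i]. *)
Lemma tridiag_form_rank1_ge0 N v w :
  (exists j, forall i, (i <= N)%N -> i != j -> i != j.+1 -> v i = 0) ->
  0 <= tridiag_form N (sqv v) (mulv v) (sqv w) (mulv w).
Proof.
move=> [j vz].
have -> : tridiag_form N (sqv v) (mulv v) (sqv w) (mulv w) =
    (\sum_(0 <= i < N.+1) v i * w i) ^+ 2.
  rewrite expr2 mulr_suml; under [RHS]eq_bigr do rewrite mulr_sumr.
  pose f i k := if (i <= k.+1)%N && (k <= i.+1)%N then v i * w i * (v k * w k) else 0 : R.
  rewrite (_ : \sum_(0 <= i < N.+1) _ =
      \sum_(0 <= i < N.+1) \sum_(0 <= k < N.+1) f i k); last first.
    rewrite !big_nat; apply: eq_bigr => i /andP[_ iN].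
    rewrite !big_nat; apply: eq_bigr => k /andP[_ kN].
    rewrite /f; case: ifPn => // ik.
    have [ij|ij] := eqVneq i j; last have [ij1|ij1] := eqVneq i j.+1.
    - rewrite (vz k) ?mul0r ?mulr0//; lia.
    - rewrite (vz k) ?mul0r ?mulr0//; lia.
    - by rewrite (vz i) ?mul0r.
  rewrite sum_tridiag => [||i k ik]; last 2 first.
  - move=> i k; rewrite /f andbC; case: ifP => // _; exact: mulrC.
  - rewrite /f ifN//; lia.
  rewrite /tridiag_form; congr (_ + 2 * _); apply: eq_bigr => i _.
    by rewrite /f leqnSn /= /sqv; ring.
  rewrite /f ifT; last lia.
  by rewrite /mulv; ring.
exact: sqr_ge0.
Qed.

Lemma big_nat_only n j (F : nat -> R) : (j < n)%N ->
  (forall i, i != j -> F i = 0) -> \sum_(0 <= i < n) F i = F j.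
Proof.
move=> jn F0; rewrite (bigD1_seq j) ?iota_uniq ?mem_index_iota//=.
by rewrite big1 ?addr0.
Qed.

Lemma tridiag_form_two N p q v j : (j < N)%N ->
  (forall i, i != j -> i != j.+1 -> v i = 0) ->
  tridiag_form N p q (sqv v) (mulv v) =
  p j * v j ^+ 2 + p j.+1 * v j.+1 ^+ 2 + 2 * (q j * (v j * v j.+1)).
Proof.
move=> jN v0; rewrite /tridiag_form; congr (_ + 2 * _).
  rewrite (bigD1_seq j) ?iota_uniq ?mem_index_iota ?ltnS ?(ltnW jN)//=.
  congr (_ + _); rewrite big_mkcond/= (@big_nat_only _ j.+1)// ?ifT//; first lia.
  by move=> i ij1; case: ifPn => // ij; rewrite /sqv v0// expr0n mulr0.
rewrite (@big_nat_only _ j)// => i ij; rewrite /mulv.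
have [->|ij1] := eqVneq i j.+1; first by rewrite (v0 j.+2) ?mulr0//; lia.
by rewrite (v0 i) ?mul0r ?mulr0.
Qed.

Definition two_point j (c d : R) (l : nat) : R :=
  if l == j then c else if l == j.+1 then d else 0.

Lemma tridiag_form_two_point N p q j (c d : R) : (j < N)%N ->
  tridiag_form N p q (sqv (two_point j c d)) (mulv (two_point j c d)) =
  p j * c ^+ 2 + p j.+1 * d ^+ 2 + 2 * (q j * (c * d)).
Proof.
move=> jN; rewrite (tridiag_form_two _ _ jN); last first.
  by move=> i /negbTE ij /negbTE ij1; rewrite /two_point ij ij1.
by rewrite /two_point eqxx (_ : (j.+1 == j) = false) ?eqxx//; lia.
Qed.

Lemma two_point_neq0 N j (c d : R) : (j < N)%N -> (c != 0) || (d != 0) ->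
  exists2 i, (i <= N)%N & two_point j c d i != 0.
Proof.
move=> jN /orP[c0|d0]; [exists j|exists j.+1] => //; rewrite /two_point ?eqxx//.
  exact: ltnW.
by rewrite (_ : (j.+1 == j) = false) ?eqxx//; lia.
Qed.

(** The cone is cut out by finitely many strict inequalities, all of which survive
    a small decrease of the diagonal. *)
Lemma chain_cone_margin N a x : chain_cone N a x ->
  exists2 t, 0 < t & chain_cone N (fun i => a i - t) x.
Proof.
move=> [a0 d0].
have min (P : nat -> R -> Prop) n :
    (forall i, (i < n)%N -> exists2 t, 0 < t & forall u, 0 < u -> u <= t -> P i u) ->
    exists2 t, 0 < t & forall i u, (i < n)%N -> 0 < u -> u <= t -> P i u.
  elim: n => [|n IH] H; first by exists 1.
  have [t t0 tP] := IH (fun i iN => H i (ltnW iN)).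
  have [t' t'0 t'P] := H n (ltnSn n).
  exists (Num.min t t'); first by rewrite lt_min t0.
  move=> i u; rewrite ltnS leq_eqVlt => /predU1P[->|iN] u0; rewrite le_min => /andP[ut ut'].
    exact: t'P.
  exact: tP.
have H1 i : (i < N.+1)%N ->
    exists2 t, 0 < t & forall u, 0 < u -> u <= t -> 0 < a i - u.
  move=> iN; have ai := a0 i iN; exists (a i / 2); first by rewrite divr_gt0.
  by move=> u u0 ut; lra.
have H2 j : (j < N)%N ->
    exists2 t, 0 < t & forall u, 0 < u -> u <= t ->
      0 < (a j - u) * (a j.+1 - u) - x j ^+ 2.
  move=> jN; have dj := d0 j jN.
  have aj := a0 j (ltnW jN); have aj1 := a0 j.+1 jN.
  exists ((a j * a j.+1 - x j ^+ 2) / (2 * (a j + a j.+1))).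
    by rewrite divr_gt0// mulr_gt0// addr_gt0.
  move=> u u0; rewrite ler_pdivlMr; last by rewrite mulr_gt0// addr_gt0.
  by move=> ut; nra.
have [t1 t10 t1P] := min (fun i u => 0 < a i - u) _ H1.
have [t2 t20 t2P] := min (fun j u => 0 < (a j - u) * (a j.+1 - u) - x j ^+ 2) _ H2.
exists (Num.min t1 t2); first by rewrite lt_min t10.
split=> i iN.
  by apply: t1P => //; rewrite ?ge_min ?lexx// lt_min t10.
by apply: t2P => //; rewrite ?ge_min ?lexx ?orbT// lt_min t10.
Qed.

Lemma PG_entry_le N (y : 'M[R]_N.+1) p q i j : y = tridiag_mx N p q -> PG y ->
  `|y i j| <= \sum_(0 <= k < N.+1) p k.
Proof.
move=> yE Py.
have pd := Py; rewrite yE in pd; move/PG_tridiag : pd => pd.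
have two k (c d : R) : (k < N)%N -> (c != 0) || (d != 0) ->
    0 < p k * c ^+ 2 + p k.+1 * d ^+ 2 + 2 * (q k * (c * d)).
  move=> kN cd; rewrite -(tridiag_form_two_point p q c d kN).
  by apply: pd; exact: two_point_neq0.
have pi k : (k <= N)%N -> 0 < p k.
  move=> kN; have := pd (fun l => (l == k)%:R).
  rewrite /tridiag_form (@big_nat_only _ k)//; last first.
    by move=> l /negbTE lk; rewrite /sqv lk expr0n mulr0.
  rewrite big1 => [|l _]; last first.
    rewrite /mulv; case: eqP => [->|_]; last by rewrite mul0r mulr0.
    by rewrite (_ : (k.+1 == k) = false) ?mulr0 ?mulr0//; lia.
  rewrite /sqv eqxx expr1n mulr1 mulr0 addr0; apply.
  by exists k => //; rewrite eqxx oner_neq0.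
have sum_ge k : (k <= N)%N -> p k <= \sum_(0 <= l < N.+1) p l.
  move=> kN; rewrite (bigD1_seq k) ?iota_uniq ?mem_index_iota//= lerDl.
  rewrite big_seq_cond; apply: sumr_ge0 => l; rewrite mem_index_iota => /andP[lN _].
  by apply/ltW/pi.
have qle k : (k < N)%N -> `|q k| <= \sum_(0 <= l < N.+1) p l.
  move=> kN.
  have H1 := two k 1 1 kN; have H2 := two k 1 (-1) kN.
  rewrite oner_neq0 in H1 H2; move: (H1 isT) (H2 isT) => {H1 H2}.
  rewrite sqrrN expr1n !mulr1 mulrN1.
  have := sum_ge k (ltnW kN); have := sum_ge k.+1 kN.
  rewrite ler_norml; lra.
have tr0 : 0 <= \sum_(0 <= k < N.+1) p k by apply: le_trans (sum_ge 0%N _); rewrite ?ltW ?pi.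
rewrite yE mxE; case: eqP => _.
  by rewrite gtr0_norm ?sum_ge ?pi// -ltnS.
case: eqP => [ji|_]; first by apply: qle; rewrite -ltnS -ji.
case: eqP => [ij|_]; first by apply: qle; rewrite -ltnS -ij.
by rewrite normr0.
Qed.

(** Testing against [v v^T] with [v] supported by an edge gives one direction.
    Conversely, with a margin [t] in the cone, [pairing y eta] is at least [t] times
    the trace of [y] for [y] positive definite, hence at least [t * `|y i j|]; this
    closed condition passes to the closure and forbids a zero pairing. *)
Lemma QGE N (eta : @IG R N.+1) : (0 < N)%N ->
  QG eta <-> chain_cone N (coord1 eta) (coord2 eta).
Proof.
move=> N0; split=> [Qeta|cone y].
  have quad j (c d : R) : (j < N)%N -> (c != 0) || (d != 0) ->
    0 < coord1 eta j * c ^+ 2 + coord1 eta j.+1 * d ^+ 2 + 2 * (coord2 eta j * (c * d)).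
    move=> jN cd; rewrite -(tridiag_form_two_point (coord1 eta) (coord2 eta) c d jN).
    have [i iN vi] := two_point_neq0 jN cd.
    rewrite -tridiag_form_sqv -pairing_tridiag; apply: Qeta.
      apply: closure_PG_tridiag => w; apply: tridiag_form_rank1_ge0.
      by exists j => k _ /negbTE kj /negbTE kj1; rewrite /two_point kj kj1.
    apply: contra vi => /eqP/matrixP/(_ (inord i) (inord i)).
    by rewrite !mxE eqxx inordK// /sqv => /eqP; rewrite sqrf_eq0.
  have a0 i : (i <= N)%N -> 0 < coord1 eta i.
    rewrite leq_eqVlt => /predU1P[->|iN].
      have := @quad N.-1 0 1; rewrite prednK// leqnn oner_neq0 orbT => /(_ isT isT).
      by rewrite expr0n expr1n !(mul0r,mulr0,mulr1,addr0,add0r).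
    have := @quad i 1 0 iN; rewrite oner_neq0 => /(_ isT).
    by rewrite expr0n expr1n !(mul0r,mulr0,mulr1,addr0,add0r).
  split => // j jN; have aj1 := a0 j.+1 jN.
  (* at this vector the quadratic form is a j.+1 times the minor *)
  have := @quad j (coord1 eta j.+1) (- coord2 eta j) jN.
  rewrite gt_eqF//= => /(_ isT).
  rewrite (_ : _ + _ + _ = coord1 eta j.+1 *
    (coord1 eta j * coord1 eta j.+1 - coord2 eta j ^+ 2)); last ring.
  by rewrite pmulr_rgt0.
have [t t0 cone'] := chain_cone_margin cone.
move=> clo y0.
have bound i j : t * `|y i j| <= pairing y eta.
  pose A := (fun z : 'M[R]_N.+1 => pairing z eta - t * `|z i j|) @^-1` [set u | 0 <= u].
  have cA : closed A.
    apply: preimage_closed; last exact: closed_ge.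
    move=> z _; have /(_ z) cij := @coord_continuous R N.+1 N.+1 i j.
    apply: (@continuousB R _ _ (fun z : 'M[R]_N.+1 => pairing z eta)
      (fun z : 'M[R]_N.+1 => t * `|z i j|) z); first exact: continuous_pairing.
    apply: (@continuousM R _ (cst t) (fun z : 'M[R]_N.+1 => `|z i j|) z).
      exact: cst_continuous.
    apply: (@continuous_comp _ _ _ (fun z : 'M[R]_N.+1 => z i j) (@Num.norm R R)).
      exact: cij.
    exact: norm_continuous.
  have : A y.
    suff : closure (@PG R N.+1) `<=` A by apply.
    rewrite closureE; apply: smallest_sub => // z Pz.
    rewrite /A /= subr_ge0.
    have [r [e [b [r0 e0 [p [q [zE E]]]]]]] := PG_chain_form (leq0n N) Pz.
    apply: (le_trans (ler_wpM2l (ltW t0) (PG_entry_le i j zE Pz))).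
    rewrite zE pairing_tridiag -/(coord1 eta) -/(coord2 eta).
    have -> : tridiag_form N p q (coord1 eta) (coord2 eta) =
       tridiag_form N p q (fun i => coord1 eta i - t) (coord2 eta)
       + t * \sum_(0 <= k < N.+1) p k.
      rewrite /tridiag_form [in RHS]addrAC [t * _]mulr_sumr -big_split /=; congr (_ + _).
      by apply: eq_bigr => k _; ring.
    by rewrite lerDr E; exact: chain_form_ge0 cone'.
  by rewrite /A /= subr_ge0.
have [i [j yij]] : exists i j, y i j != 0.
  apply: contrapT => H; case/eqP : y0; apply/matrixP => i j; rewrite mxE.
  by apply/eqP/negPn/negP => ?; apply: H; exists i, j.
by apply: lt_le_trans (bound i j); rewrite mulr_gt0 ?normr_gt0.
Qed.

Lemma measurable_coord1 N i : measurable_fun setT (fun eta : IG N.+1 => coord1 eta i).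
Proof. by apply: measurable_nth_tuple; exact: measurable_fst. Qed.

Lemma measurable_coord2 N i : measurable_fun setT (fun eta : IG N.+1 => coord2 eta i).
Proof. by apply: measurable_nth_tuple; exact: measurable_snd. Qed.

Lemma measurable_QG N : (0 < N)%N -> measurable (@QG R N.+1).
Proof.
move=> N0.
rewrite (_ : @QG R N.+1 =
  (\bigcap_(i in `I_N.+1) (fun eta => coord1 eta i) @^-1` `]0, +oo[) `&`
  (\bigcap_(j in `I_N) (fun eta => coord1 eta j * coord1 eta j.+1 - coord2 eta j ^+ 2)
      @^-1` `]0, +oo[)).
  apply: measurableI; apply: bigcap_measurableType => i _;
    rewrite -[X in measurable X]setTI.
    by apply: measurable_coord1.
  suff mf : measurable_fun setT (fun eta : IG N.+1 =>
      coord1 eta i * coord1 eta i.+1 - coord2 eta i ^+ 2) by apply: mf.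
  apply: measurable_funB; first by apply: measurable_funM; exact: measurable_coord1.
  by apply: measurable_funX; exact: measurable_coord2.
apply/seteqP; split => eta.
  move=> /(QGE _ N0)[a0 d0]; split => i /= iN; rewrite in_itv/= andbT.
    exact: a0.
  exact: d0.
move=> [a0 d0]; apply/(QGE _ N0); split => i iN.
  by have := a0 i iN; rewrite /= in_itv/= andbT.
by have := d0 i iN; rewrite /= in_itv/= andbT.
Qed.

End QG_cone.

(** * Two by two blocks and their inverses *)

Section two_by_two_blocks.
Context {R : realType}.

(** A block is indexed by an enumeration of a two element set, of which only the
    injectivity and the image are used. *)
Section reindexed.
Variables (n k : nat) (A : 'M[R]_n) (f : 'I_k -> 'I_n) (u v : 'I_n).
Hypotheses (k2 : k = 2%N) (f_inj : injective f)
  (f_im : forall a, f a = u \/ f a = v).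

Let B : 'M[R]_k := \matrix_(a, b) A (f a) (f b).
Let D := A u u * A v v - A u v * A v u.

Lemma det_reindexed2 : \det B = D.
Proof.
move: f f_inj f_im @B; rewrite k2 => g gI gim /=.
rewrite (expand_det_row _ 0) !big_ord_recl big_ord0 addr0 /cofactor.
rewrite !(det_mx11, mxE) /= expr0 expr1.
have -> : lift 0 0 = 1 :> 'I_2 by exact: val_inj.
have -> : lift 1 0 = 0 :> 'I_2 by exact: val_inj.
have g01 : g 0 <> g 1 by move=> /gI.
by case: (gim 0) (gim 1) g01 => -> [] -> // _; rewrite /D; ring.
Qed.

Lemma invmx_reindexed2 a b : u != v -> D != 0 ->
  invmx B a b = D^-1 * (if f a == u then if f b == u then A v v else - A u v
                        else if f b == u then - A v u else A u u).
Proof.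
move=> uv D0; move: det_reindexed2 a b.
rewrite /B; move: f f_inj f_im; rewrite k2 => g gI gim detB a b.
set C := \matrix_(_, _) _.
pose G := \matrix_(a, b) (D^-1 * (if g a == u then if g b == u then A v v else - A u v
                        else if g b == u then - A v u else A u u)).
have CG : C *m G = 1%:M.
  apply/matrixP => i j; rewrite !mxE !big_ord_recl big_ord0 addr0 !mxE.
  have -> : lift 0 0 = 1 :> 'I_2 by exact: val_inj.
  have g01 : g 0 <> g 1 by move=> /gI.
  have ij : (i == j) = (g i == g j) by rewrite (inj_eq gI).
  have uvF := negbTE uv; have vuF : (v == u) = false by rewrite eq_sym.
  rewrite ij; move: (gim i) (gim j); move: D0; rewrite /D => D0.
  case: (gim 0) (gim 1) g01 => -> [] -> // _ [] -> [] ->;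
    by rewrite !(eqxx, uvF, vuF) /=; field.
have -> : invmx C = G.
  have [Cu _] := mulmx1_unit CG.
  by rewrite -[invmx C]mulmx1 -CG mulmxA mulVmx// mul1mx.
by rewrite mxE.
Qed.

End reindexed.

Lemma interval_set_edge N j : (j < N)%N ->
  interval_set N.+1 j.+1 j.+2 = [set inord j; inord j.+1]%SET.
Proof.
move=> jN; apply/setP => k; rewrite !inE -!val_eqE /= !inordK; lia.
Qed.

Lemma mem_interval_set_edge N j (l : 'I_N.+1) : (j < N)%N ->
  (l \in interval_set N.+1 j.+1 j.+2) = (l == inord j) || (l == inord j.+1).
Proof. by move=> jN; rewrite interval_set_edge// !inE. Qed.

Lemma inord_neqS N j : (j < N)%N -> inord j != inord j.+1 :> 'I_N.+1.
Proof. by move=> jN; rewrite -val_eqE /= !inordK; lia. Qed.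

Lemma card_interval_set_edge N j : (j < N)%N ->
  #|interval_set N.+1 j.+1 j.+2| = 2%N.
Proof. by move=> jN; rewrite interval_set_edge// cards2 inord_neqS. Qed.

Lemma IGmx_edge N (eta : @IG R N.+1) j : (j < N)%N ->
  [/\ IGmx eta (inord j) (inord j) = coord1 eta j,
     IGmx eta (inord j.+1) (inord j.+1) = coord1 eta j.+1,
     IGmx eta (inord j) (inord j.+1) = coord2 eta j &
     IGmx eta (inord j.+1) (inord j) = coord2 eta j].
Proof.
move=> jN; rewrite IGmx_tridiag !mxE !eqxx -!val_eqE /= !inordK ?ltnS//; last first.
  exact: ltnW.
by rewrite !eqxx !ifF//; lia.
Qed.

Definition edge_det N (eta : @IG R N.+1) j :=
  coord1 eta j * coord1 eta j.+1 - coord2 eta j ^+ 2.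

Lemma edge_detE N M (eta : @IG R N.+1) j : edge_det eta j =
  coord1 eta (edge_parent M j) * coord1 eta (edge_child M j) - coord2 eta j ^+ 2.
Proof.
rewrite /edge_det /edge_parent /edge_child; case: ifP => _ //.
by rewrite [X in X - _]mulrC.
Qed.

Lemma det_block N (eta : @IG R N.+1) j : (j < N)%N ->
  \det (block eta j.+1 j.+2) = edge_det eta j.
Proof.
move=> jN; have [e1 e2 e3 e4] := IGmx_edge eta jN.
rewrite (@det_reindexed2 _ _ (IGmx eta) enum_val (inord j) (inord j.+1)) ?e1 ?e2 ?e3 ?e4//.
- exact: card_interval_set_edge.
- exact: enum_val_inj.
- move=> a; have := enum_valP a; rewrite mem_interval_set_edge//.
  by case/orP => /eqP; [left|right].
Qed.

Lemma block_inv0_represents N (eta : @IG R N.+1) j : (j < N)%N ->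
  edge_det eta j != 0 ->
  represents (block_inv0 eta j.+1 j.+2) (fun a x => (edge_det eta j)^-1 *
    (coord1 eta j.+1 * a j - 2 * coord2 eta j * x j + coord1 eta j * a j.+1)).
Proof.
move=> jN D0; have [e1 e2 e3 e4] := IGmx_edge eta jN.
set D := edge_det eta j in D0 *.
pose p i : R := if i == j then D^-1 * coord1 eta j.+1
            else if i == j.+1 then D^-1 * coord1 eta j else 0.
pose q i : R := if i == j then - (D^-1 * coord2 eta j) else 0.
exists p, q; split; last first.
  move=> a x; rewrite /tridiag_form.
  rewrite (bigD1_seq j) ?iota_uniq ?mem_index_iota ?ltnS ?(ltnW jN)//=.
  rewrite big_mkcond/= (@big_nat_only _ _ j.+1)//; last first.
    by move=> i /negbTE ij1; rewrite /p ij1; case: ifP => // /negbTE ->; rewrite mul0r.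
  rewrite (@big_nat_only _ _ j)//; last by move=> i /negbTE ij; rewrite /q ij mul0r.
  rewrite /p /q !eqxx (_ : (j.+1 == j) = false) /=; last lia.
  by ring.
apply/matrixP => i k; rewrite /block_inv0 /zero_ext mxE.
pose g (l l' : 'I_N.+1) : R := D^-1 *
  (if l == inord j then if l' == inord j then coord1 eta j.+1 else - coord2 eta j
   else if l' == inord j then - coord2 eta j else coord1 eta j).
have invE a b : invmx (block eta j.+1 j.+2) a b = g (enum_val a) (enum_val b).
  rewrite (@invmx_reindexed2 _ _ (IGmx eta) enum_val (inord j) (inord j.+1)).
  - by rewrite e1 e2 e3 e4 -expr2.
  - exact: card_interval_set_edge.
  - exact: enum_val_inj.
  - by move=> c; have := enum_valP c; rewrite mem_interval_set_edge// => /orP[] /eqP; [left|right].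
  - exact: inord_neqS.
  - by rewrite e1 e2 e3 e4 -expr2.
transitivity (\sum_(a : 'I_#|interval_set N.+1 j.+1 j.+2| | enum_val a == i)
    \sum_(b : 'I_#|interval_set N.+1 j.+1 j.+2| | enum_val b == k) g i k).
  apply: eq_bigr => a /eqP ai; apply: eq_bigr => b /eqP bk.
  by rewrite invE ai bk.
have sumB (l : 'I_N.+1) (c : R) :
    \sum_(a : 'I_#|interval_set N.+1 j.+1 j.+2| | enum_val a == l) c =
    if (l == inord j) || (l == inord j.+1) then c else 0.
  rewrite -mem_interval_set_edge//; case: ifPn => lB; last first.
    by rewrite big1// => a /eqP al; case/negP: lB; rewrite -al enum_valP.
  rewrite (big_pred1 (enum_rank_in lB l))// => a /=.
  by rewrite -(inj_eq enum_val_inj) enum_rankK_in.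
rewrite !sumB /g /p /q !mxE -!val_eqE /= !inordK; [|lia..].
have jj : (j == j.+1) = false by lia.
have j1j : (j.+1 == j) = false by lia.
have [ij|ij] := eqVneq (i : nat) j; have [ij1|ij1] := eqVneq (i : nat) j.+1;
  have [kj|kj] := eqVneq (k : nat) j; have [kj1|kj1] := eqVneq (k : nat) j.+1;
  rewrite ?ij ?ij1 ?kj ?kj1 ?eqxx ?jj ?j1j //=; try lia.
all: rewrite ?mulrN //; do ?(case: eqP => //= ?); try lia.
Qed.

Lemma diag_entryE N (eta : @IG R N.+1) i : (i <= N)%N ->
  diag_entry eta i.+1 = coord1 eta i.
Proof.
move=> iN; rewrite /diag_entry /=; case: insubP => [u _ ui|]; last by rewrite ltnS iN.
by rewrite (tnth_nth 0) ui.
Qed.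

Lemma diag_inv0_represents N (eta : @IG R N.+1) i : (i <= N)%N ->
  represents (diag_inv0 eta i.+1) (fun a _ => (coord1 eta i)^-1 * a i).
Proof.
move=> iN; exists (fun k => if k == i then (coord1 eta i)^-1 else 0), (fun=> 0).
split=> [|a x]; last first.
  rewrite /tridiag_form (@big_nat_only _ _ i)// ?eqxx; last first.
    by move=> k /negbTE ->; rewrite mul0r.
  by rewrite big1 ?mulr0 ?addr0// => k _; rewrite mul0r.
apply/matrixP => k l; rewrite !mxE diag_entryE// !eqSS.
case: (k =P l) => [->|kl]; first by rewrite andbb.
rewrite ifF; first by do 2 case: ifP => //.
by apply/negP => /andP[/eqP ki /eqP li]; apply: kl; apply: val_inj; rewrite /= ki li.
Qed.

End two_by_two_blocks.

(** * The weight is a chain density, the inverse formula a chain form *)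

Section weight.
Context {R : realType}.
Implicit Types (a x h : nat -> R) (s : nat -> R) (N M : nat).

(** The exponent attached to an edge is that of its child; the shift passes from
    vertices counted from [0] to the indices [1..n] of [s]. *)
Definition edge_shape s M j : R := s (edge_child M j).+1.

Lemma sum_edges N M (F : nat -> nat -> nat -> R) : (M <= N)%N ->
  \sum_(0 <= j < N) F j (edge_parent M j) (edge_child M j) =
  \sum_(0 <= j < M) F j j.+1 j + \sum_(M <= j < N) F j j j.+1.
Proof.
move=> MN; rewrite (big_cat_nat (n := M))//=; congr (_ + _); apply: eq_big_nat => j.
  by move=> /andP[_ jM]; rewrite /edge_parent /edge_child jM.
by move=> /andP[Mj _]; rewrite /edge_parent /edge_child ltnNge Mj.
Qed.

(** A vertex other than the root and the two ends is the parent of exactly one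
   edge; the root is the parent of its (at most two) edges, and the missing
   ones are accounted for by [s 0 = s N.+2 = 0]. *)
Lemma sum_edge_parent N M s h : (M <= N)%N -> (0 < N)%N -> s 0%N = 0 -> s N.+2 = 0 ->
  \sum_(0 <= j < N) edge_shape s M j * h (edge_parent M j) =
  \sum_(1 <= i < M) s i * h i + (s M + s M.+2) * h M
  + \sum_(M.+1 <= i < N) s i.+2 * h i.
Proof.
move=> MN N0 s0 sN; rewrite (sum_edges (fun j p c => s c.+1 * h p) MN) mulrDl.
have -> : \sum_(0 <= j < M) s j.+1 * h j.+1 = \sum_(1 <= i < M) s i * h i + s M * h M.
  case: M MN => [|M] MN; first by rewrite !big_geq// s0 mul0r addr0.
  by rewrite big_nat_recr//= big_add1.
have -> : \sum_(M <= j < N) s j.+2 * h j =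
    s M.+2 * h M + \sum_(M.+1 <= i < N) s i.+2 * h i.
  move: MN; rewrite leq_eqVlt => /predU1P[->|MN]; last by rewrite big_ltn.
  by rewrite !big_geq// sN mul0r addr0.
by ring.
Qed.

Lemma sum_parent N M h : (M <= N)%N -> (0 < N)%N ->
  \sum_(0 <= j < N) h (edge_parent M j) = \sum_(1 <= i < N) h i + h M.
Proof.
move=> MN N0; rewrite (sum_edges (fun _ p _ => h p) MN).
have -> : \sum_(0 <= j < M) h j.+1 = \sum_(1 <= i < M.+1) h i by rewrite big_add1.
case: M MN => [|M] MN; first by rewrite big_geq// add0r big_ltn// addrC.
move: MN; rewrite leq_eqVlt => /predU1P[<-|MN].
  by rewrite (big_geq (leqnn _)) addr0 big_nat_recr.
rewrite [in RHS](big_cat_nat (n := M.+2))//= -addrA; congr (_ + _).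
by rewrite (big_ltn MN) addrC.
Qed.

Lemma inverse_mean_represents N M s (m : IG N.+1) : (M <= N)%N -> (0 < N)%N ->
  s 0%N = 0 -> s N.+2 = 0 -> QG m ->
  represents
   (\sum_(1 <= k < M.+1) s k *: block_inv0 m k k.+1
      + \sum_(M.+2 <= k < N.+2) s k *: block_inv0 m k.-1 k
      - \sum_(2 <= k < M.+1) s k.-1 *: diag_inv0 m k
      - (s M.+1.-1 - s M.+1 + s M.+2) *: diag_inv0 m M.+1
      - \sum_(M.+2 <= k < N.+1) s k.+1 *: diag_inv0 m k)
   (chain_form N M (s M.+1 / coord1 m M)
     (fun j => edge_shape s M j * coord1 m (edge_parent M j) / edge_det m j)
     (fun j => - (coord2 m j / coord1 m (edge_parent M j)))).
Proof.
move=> MN N0 s0 sN /(QGE _ N0) cone; have [m0 d0] := cone.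
have rblock j : (j < N)%N -> represents (block_inv0 m j.+1 j.+2)
   (fun a x => (edge_det m j)^-1 *
    (coord1 m j.+1 * a j - 2 * coord2 m j * x j + coord1 m j * a j.+1)).
  by move=> jN; apply: block_inv0_represents => //; rewrite gt_eqF ?d0.
rewrite !big_add1 /=.
apply: (@eq_represents _ _ _ (fun a x =>
   \sum_(0 <= j < M) s j.+1 * ((edge_det m j)^-1 *
     (coord1 m j.+1 * a j - 2 * coord2 m j * x j + coord1 m j * a j.+1))
 + \sum_(M <= j < N) s j.+2 * ((edge_det m j)^-1 *
     (coord1 m j.+1 * a j - 2 * coord2 m j * x j + coord1 m j * a j.+1))
 - \sum_(0 <= i < M.-1) s i.+1 * ((coord1 m i.+1)^-1 * a i.+1)
 - (s M - s M.+1 + s M.+2) * ((coord1 m M)^-1 * a M)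
 - \sum_(M <= i < N.-1) s i.+3 * ((coord1 m i.+1)^-1 * a i.+1))) => [a x|]; last first.
  apply: representsB; last first.
    apply: represents_sum => i ?; apply: representsZ.
    by apply: diag_inv0_represents; lia.
  apply: representsB; last by apply: representsZ; exact: diag_inv0_represents.
  apply: representsB; last first.
    apply: represents_sum => i ?; apply: representsZ.
    by apply: diag_inv0_represents; lia.
  by apply: representsD; apply: represents_sum => j ?; apply: representsZ;
    apply: rblock; lia.
pose h i := (coord1 m i)^-1 * a i.
pose T j p c := s c.+1 * ((edge_det m j)^-1 *
     (coord1 m p * a c - 2 * coord2 m j * x j + coord1 m c * a p)).
transitivity (\sum_(0 <= j < N) T j (edge_parent M j) (edge_child M j)
  - \sum_(0 <= j < N) edge_shape s M j * h (edge_parent M j) + s M.+1 * h M).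
  rewrite (sum_edge_parent h MN N0 s0 sN) (sum_edges T MN) !big_add1.
  have -> : \sum_(0 <= j < M) T j j.+1 j = \sum_(0 <= j < M) s j.+1 * ((edge_det m j)^-1 *
     (coord1 m j.+1 * a j - 2 * coord2 m j * x j + coord1 m j * a j.+1)) by [].
  have -> : \sum_(M <= j < N) s j.+2 * ((edge_det m j)^-1 *
     (coord1 m j.+1 * a j - 2 * coord2 m j * x j + coord1 m j * a j.+1)) =
     \sum_(M <= j < N) T j j j.+1 by apply: eq_bigr => j _; rewrite /T; ring.
  by rewrite /h; ring.
rewrite /chain_form addrC; congr (_ + _); first by rewrite /h; ring.
rewrite -sumrB; apply: eq_big_nat => j /andP[_ jN].
have [pa0 _] := chain_cone_edge M cone jN.
have dj : edge_det m j != 0 by rewrite gt_eqF ?d0.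
rewrite /T /h /edge_form -/(edge_shape s M j).
rewrite (edge_detE M) in dj *; field.
by rewrite dj gt_eqF.
Qed.

Lemma powR_expR (u t : R) : 0 < u -> u `^ t = expR (t * ln u).
Proof. by move=> u0; rewrite /powR gt_eqF. Qed.

(** All factors are positive, so both sides are exponentials of linear
    combinations of the logarithms of the minors and of the diagonal entries. *)
Lemma delta_phiE N M s (eta : @IG R N.+1) : (M <= N)%N -> (0 < N)%N ->
  s 0%N = 0 -> s N.+2 = 0 -> QG eta ->
  delta M.+1 s eta * phi eta =
  coord1 eta M `^ (s M.+1 - 1) *
  \prod_(0 <= j < N) (
    (coord1 eta (edge_child M j) - coord2 eta j ^+ 2 / coord1 eta (edge_parent M j))
       `^ (edge_shape s M j - 3 / 2) / Num.sqrt (coord1 eta (edge_parent M j))).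
Proof.
move=> MN N0 s0 sN /(QGE _ N0) cone; have [a0 d0] := cone.
pose D j := ln (edge_det eta j); pose A i := ln (coord1 eta i).
have dpow j t : (j < N)%N -> (\det (block eta j.+1 j.+2)) `^ t = expR (t * D j).
  by move=> jN; rewrite det_block// powR_expR// d0.
have apow i t : (i <= N)%N -> diag_entry eta i.+1 `^ t = expR (t * A i).
  by move=> iN; rewrite diag_entryE// powR_expR// a0.
rewrite /delta /phi !big_add1 /=.
have P1 : \prod_(0 <= i < M) (\det (block eta i.+1 i.+2)) `^ (s i.+1) =
    expR (\sum_(0 <= j < M) s j.+1 * D j).
  by rewrite expR_sum; apply: eq_big_nat => j ?; rewrite dpow//; lia.
have P2 : \prod_(M <= i < N) (\det (block eta i.+1 i.+2)) `^ (s i.+2) =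
    expR (\sum_(M <= j < N) s j.+2 * D j).
  by rewrite expR_sum; apply: eq_big_nat => j ?; rewrite dpow//; lia.
have P3 : \prod_(0 <= i < M.-1) diag_entry eta i.+2 `^ (s i.+1) =
    expR (\sum_(1 <= i < M) s i * A i).
  by rewrite big_add1 expR_sum; apply: eq_big_nat => j ?; rewrite apow//; lia.
have P4 : \prod_(M <= i < N.-1) diag_entry eta i.+2 `^ (s i.+3) =
    expR (\sum_(M.+1 <= i < N) s i.+2 * A i).
  by rewrite big_add1 expR_sum; apply: eq_big_nat => j ?; rewrite apow//; lia.
have P5 : \prod_(0 <= i < N) (\det (block eta i.+1 i.+2)) `^ (- (3 / 2)) =
    expR (\sum_(0 <= j < N) - (3 / 2) * D j).
  by rewrite expR_sum; apply: eq_big_nat => j ?; rewrite dpow//; lia.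
have P6 : \prod_(0 <= i < N.-1) diag_entry eta i.+2 = expR (\sum_(1 <= i < N) A i).
  rewrite big_add1 expR_sum; apply: eq_big_nat => j ?.
  by rewrite diag_entryE ?lnK ?posrE ?a0//; lia.
have P7 : coord1 eta M `^ (s M.+1 - 1) = expR ((s M.+1 - 1) * A M).
  by rewrite powR_expR// a0.
have P8 : \prod_(0 <= j < N) (
    (coord1 eta (edge_child M j) - coord2 eta j ^+ 2 / coord1 eta (edge_parent M j))
       `^ (edge_shape s M j - 3 / 2) / Num.sqrt (coord1 eta (edge_parent M j))) =
  expR (\sum_(0 <= j < N) ((edge_shape s M j - 3 / 2) * (D j - A (edge_parent M j))
     - 1 / 2 * A (edge_parent M j))).
  rewrite expR_sum; apply: eq_big_nat => j /andP[_ jN].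
  have [pa0 _] := chain_cone_edge M cone jN.
  have -> : coord1 eta (edge_child M j) - coord2 eta j ^+ 2 / coord1 eta (edge_parent M j)
     = edge_det eta j / coord1 eta (edge_parent M j).
    by rewrite (edge_detE M); field; rewrite gt_eqF.
  rewrite powR_expR ?divr_gt0 ?d0// ln_div ?posrE ?d0// expRB; congr (_ / _).
  by rewrite -powR12_sqrt ?ltW// powR_expR// div1r.
rewrite P1 P2 P3 P4 P5 P6 P7 P8 (apow _ _ MN) -!expRD -expRN -!expRD; congr expR.
have -> : \sum_(0 <= j < N) - (3 / 2) * D j = - \sum_(0 <= j < N) 3 / 2 * D j.
  by rewrite -sumrN; apply: eq_bigr => j _; rewrite mulNr.
have -> : \sum_(0 <= j < N) ((edge_shape s M j - 3 / 2) * (D j - A (edge_parent M j))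
     - 1 / 2 * A (edge_parent M j)) =
   \sum_(0 <= j < N) edge_shape s M j * D j - \sum_(0 <= j < N) 3 / 2 * D j
   - \sum_(0 <= j < N) edge_shape s M j * A (edge_parent M j)
   + \sum_(0 <= j < N) A (edge_parent M j).
  by rewrite -!sumrB -big_split/=; apply: eq_bigr => j _; field.
rewrite (sum_parent _ MN N0) (sum_edge_parent _ MN N0 s0 sN).
rewrite (sum_edges (fun j _ c => s c.+1 * D j) MN).
ring.
Qed.

Lemma wishart_weightE N M s (y : 'M[R]_N.+1) r e b (eta : IG N.+1) :
  (M <= N)%N -> (0 < N)%N -> s 0%N = 0 -> s N.+2 = 0 ->
  represents y (chain_form N M r e b) -> QG eta ->
  wishart_weight M.+1 s y eta =
  chain_density N M (s M.+1) (edge_shape s M) r e b (coord1 eta) (coord2 eta).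
Proof.
move=> MN N0 s0 sN rep Qeta.
rewrite /wishart_weight -mulrA delta_phiE// (represents_pairing eta rep).
have /(QGE _ N0) cone := Qeta; have [a0 d0] := cone.
rewrite /chain_density /root_density a0// mul1r.
rewrite -[nth 0 _]/(coord1 eta) -[nth 0 (eta.2 : seq R)]/(coord2 eta).
rewrite [RHS](_ : _ = coord1 eta M `^ (s M.+1 - 1) * expR (- (r * coord1 eta M)) *
  \prod_(0 <= j < N) (
    (coord1 eta (edge_child M j) - coord2 eta j ^+ 2 / coord1 eta (edge_parent M j))
       `^ (edge_shape s M j - 3 / 2) / Num.sqrt (coord1 eta (edge_parent M j)) *
    expR (- (e j * edge_form (b j) (coord1 eta (edge_parent M j)) (coord2 eta j)
       (coord1 eta (edge_child M j)))))); last first.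
  congr (_ * _); apply: eq_big_nat => j /andP[_ jN].
  have [p0 q0] := chain_cone_edge M cone jN.
  by rewrite edge_density_gt0// mulrC.
rewrite [in RHS]big_split /= -expR_sum sumrN.
rewrite /chain_form opprD expRD; ring.
Qed.

Lemma chain_density_QG N M (s0 : R) s r e b (eta : IG N.+1) : (M <= N)%N -> (0 < N)%N ->
  ~ QG eta -> chain_density N M s0 s r e b (coord1 eta) (coord2 eta) = 0.
Proof.
move=> MN N0 nQ; apply/eqP/negPn/negP => /(chain_density_neq0 MN) cone.
by apply: nQ; apply/QGE.
Qed.

End weight.

(** * Measures with a density and exponential moments *)

Section density_measure.
Local Open Scope ereal_scope.
Context d (T : measurableType d) (R : realType) (mu : {measure set T -> \bar R}).
Variable g : T -> R.
Hypotheses (mg : measurable_fun setT g) (g0 : forall x, (0 <= g x)%R).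

Definition density_measure (A : set T) : \bar R := \int[mu]_(x in A) (g x)%:E.

Let density_measure0 : density_measure set0 = 0.
Proof. by rewrite /density_measure integral_set0. Qed.

Let density_measure_ge0 A : 0 <= density_measure A.
Proof. by apply: integral_ge0 => x _; rewrite lee_fin. Qed.

Let density_measure_sigma_additive : semi_sigma_additive density_measure.
Proof.
move=> F mF tF mUF; rewrite /density_measure ge0_integral_bigcup//=.
- by apply: is_cvg_nneseries => n _ _; apply: integral_ge0 => x _; rewrite lee_fin.
- exact/measurable_funTS/measurable_EFinP.
- by move=> x _; rewrite lee_fin.
Qed.

HB.instance Definition _ := isMeasure.Build _ _ _ density_measure
  density_measure0 density_measure_ge0 density_measure_sigma_additive.

Section probability.
Hypothesis g1 : \int[mu]_x (g x)%:E = 1.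

Let density_measure_setT : density_measure setT = 1.
Proof. exact: g1. Qed.

HB.instance Definition _ := Measure_isProbability.Build _ _ _ density_measure
  density_measure_setT.

Lemma probability_of_density : exists P : probability T R,
  forall A, P A = \int[mu]_(x in A) (g x)%:E.
Proof. by unshelve eexists (density_measure : probability T R). Qed.

End probability.

Import HBNNSimple.

Variable P : {measure set T -> \bar R}.
Hypothesis PE : forall A, measurable A -> P A = \int[mu]_(x in A) (g x)%:E.

Let integral_density_nnsfun (f : {nnsfun T >-> R}) :
  \int[P]_x (f x)%:E = \int[mu]_x ((f x)%:E * (g x)%:E).
Proof.
have mgE : measurable_fun setT (EFin \o g) by exact/measurable_EFinP.
under [LHS]eq_integral do rewrite fimfunE -fsumEFin//.
rewrite [LHS]ge0_integral_fsum//; last 2 first.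
  - by move=> r; exact/measurable_EFinP/measurableT_comp.
  - by move=> n x _; rewrite EFinM nnfun_muleindic_ge0.
under [RHS]eq_integral.
  move=> x xD; rewrite fimfunE -fsumEFin// muleC ge0_mule_fsumr; last first.
    by move=> r; rewrite EFinM nnfun_muleindic_ge0.
  over.
rewrite [RHS]ge0_integral_fsum//; last 2 first.
  - move=> r; apply: emeasurable_funM => //.
    exact/measurable_EFinP/measurableT_comp.
  - move=> n x _; rewrite EFinM mule_ge0//; last by rewrite nnfun_muleindic_ge0.
    by rewrite lee_fin.
apply: eq_fsbigr => r _.
have mf1 : measurable (f @^-1` [set r]) by exact: measurable_sfunP.
rewrite integralZl_indic_nnsfun//= integral_indic// setIT PE//.
have [r0|r0] := leP 0%R r; last first.
  have -> : f @^-1` [set r] = set0.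
    by apply/seteqP; split=> // x /= fx; move: r0; rewrite -fx ltNge fun_ge0.
  rewrite integral_set0 mule0 integral0_eq// => x _.
  by rewrite indicE in_set0 mulr0 mule0.
rewrite integral_mkcond epatch_indic -ge0_integralZl//; last 2 first.
  - by apply: emeasurable_funM => //; exact/measurable_EFinP.
  - by move=> x _; rewrite mule_ge0 ?lee_fin.
by apply: eq_integral => x _; rewrite -!EFinM; congr EFin; ring.
Qed.

Lemma ge0_integral_density (D : set T) (f : T -> \bar R) : measurable D ->
  measurable_fun setT f -> (forall x, 0 <= f x) ->
  \int[P]_(x in D) f x = \int[mu]_(x in D) (f x * (g x)%:E).
Proof.
move=> mD mf f0.
have mgE : measurable_fun setT (EFin \o g) by exact/measurable_EFinP.
suff full h : measurable_fun setT h -> (forall x, 0 <= h x) ->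
    \int[P]_x h x = \int[mu]_x (h x * (g x)%:E).
  rewrite integral_mkcond [RHS]integral_mkcond full.
  - apply: eq_integral => x _; rewrite !patchE; case: ifPn => // _.
    by rewrite mul0e.
  - by apply/(measurable_restrictT f) => //; exact: measurable_funTS.
  - by apply: erestrict_ge0 => x _; exact: f0.
move=> mh h0; pose h_ := nnsfun_approx measurableT mh.
have hcvg x : (h_ n x)%:E @[n --> \oo] --> h x by exact: cvg_nnsfun_approx.
transitivity (lim (\int[P]_x (h_ n x)%:E @[n --> \oo])).
  rewrite -monotone_convergence//=.
  - by apply: eq_integral => x _; apply/esym/cvg_lim.
  - by move=> n; exact/measurable_EFinP/measurable_funTS.
  - by move=> n x _; rewrite lee_fin.
  - by move=> x _ m n mn; rewrite lee_fin; exact/lefP/nd_nnsfun_approx.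
transitivity (lim (\int[mu]_x ((h_ n x)%:E * (g x)%:E) @[n --> \oo])).
  by apply: congr_lim; apply/funext => n /=; exact: integral_density_nnsfun.
rewrite -monotone_convergence//=.
- apply: eq_integral => x _; apply/cvg_lim => //.
  under eq_fun do rewrite muleC.
  by rewrite muleC; apply: cvgeZl.
- move=> n; apply: emeasurable_funM => //.
  exact/measurable_EFinP/measurable_funTS.
- by move=> n x _; rewrite mule_ge0 ?lee_fin.
- move=> x _ m n mn; rewrite lee_pmul ?lee_fin//.
  exact/lefP/nd_nnsfun_approx.
Qed.

End density_measure.

Section exponential_moments.
Context d (T : measurableType d) (R : realType) (P : {measure set T -> \bar R}).
Variable D : set T.
Hypotheses (mD : measurable D) (PD : P D = 1%E).
Implicit Types (X Y : T -> R).

Lemma integrable1 : P.-integrable D (EFin \o (fun=> 1)).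
Proof.
apply/integrableP; split; first exact: measurable_cst.
by under eq_integral do rewrite /= normr1; rewrite integral_cst// mul1e PD ltry.
Qed.

Lemma Rintegral_expR_ge X (v : R) : measurable_fun setT X ->
  P.-integrable D (EFin \o X) ->
  (\int[P]_(x in D) (expR (X x))%:E = v%:E)%E ->
  1 + \int[P]_(x in D) X x <= v.
Proof.
move=> mX iX ev.
have iE : P.-integrable D (EFin \o (fun x => expR (X x))).
  apply/integrableP; split.
    by apply/measurable_EFinP/measurable_funTS; exact: measurableT_comp.
  under eq_integral do rewrite /= ger0_norm ?expR_ge0//.
  by rewrite ev ltry.
have -> : v = \int[P]_(x in D) expR (X x) by rewrite /Rintegral ev.
have one : \int[P]_(x in D) 1 = 1 :> R.
  by rewrite /Rintegral integral_cst// mul1e PD.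
rewrite -[X in X + _]one -RintegralD//; last exact: integrable1.
apply: le_Rintegral => //; last by move=> x _; exact: expR_ge1Dx.
by have := integrableD mD integrable1 iX; apply: eq_integrable => // x _; rewrite EFinD.
Qed.

(** At [u = t * expR h] the inequality [1 + X <= expR X] says that
    [expR (- k h) + t m expR h], with [m] the mean, is minimal at [h = 0], where its
    derivative is [t m - k].  The value [u = t / 2] gives integrability. *)
Lemma gamma_mean X (k t : R) : measurable_fun setT X ->
  (forall x, D x -> 0 <= X x) -> 0 < t ->
  (forall u, 0 < u ->
    (\int[P]_(x in D) (expR ((t - u) * X x))%:E = ((u / t) `^ (- k))%:E)%E) ->
  P.-integrable D (EFin \o X) /\ \int[P]_(x in D) X x = k / t.
Proof.
move=> mX X0 t0 lap.
have iX : P.-integrable D (EFin \o X).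
  have t2 : 0 < t / 2 by rewrite divr_gt0.
  apply: (@le_integrable _ _ _ P D mD _ (fun x => (2 / t)%:E * (expR (t / 2 * X x))%:E)%E).
  - exact/measurable_EFinP/measurable_funTS.
  - move=> x Dx; rewrite -EFinM /= !lee_fin !ger0_norm ?X0//; last first.
      by rewrite mulr_ge0 ?expR_ge0// divr_ge0// ltW.
    rewrite -ler_pdivrMl ?divr_gt0// invf_div.
    by apply: le_trans (expR_ge1Dx _); rewrite lerDr.
  - apply: integrableZl => //; apply/integrableP; split.
      apply/measurable_EFinP/measurable_funTS; apply: measurableT_comp => //.
      exact: measurable_funM.
    under eq_integral do rewrite /= ger0_norm ?expR_ge0//.
    have := lap _ t2; rewrite (_ : t - t / 2 = t / 2) => [->|]; last by field.
    by rewrite ltry.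
split=> //; set m := \int[P]_(x in D) X x.
have ineq u : 0 < u -> 1 + (t - u) * m <= (u / t) `^ (- k).
  move=> u0; rewrite -RintegralZl//.
  apply: Rintegral_expR_ge (lap u u0); first exact: measurable_funM.
  by apply: eq_integrable (integrableZl mD (t - u) iX) => // x _; rewrite EFinM.
pose g (h : R) : R := expR (- k * h) + t * m * expR h.
have g_min h : g 0 <= g h.
  have := ineq (t * expR h) (mulr_gt0 t0 (expR_gt0 _)).
  rewrite mulrAC mulfV ?gt_eqF// mul1r -expRM [h * - k]mulrC.
  by rewrite /g mulr0 expR0; lra.
have dg (h : R) : is_derive h 1 g (- k * expR (- k * h) + t * m * expR h).
  apply: is_derive_eq; rewrite /GRing.scale /=.
  by rewrite ?mulr0 ?addr0 ?add0r ?mulr1; ring.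
have d0 : is_derive (0 : R) 1 g 0.
  apply: (@derive1_at_min _ g (-1) 1).
  - by lra.
  - by move=> h _; case: (dg h).
  - by rewrite in_itv/=; lra.
  - by move=> h _; exact: g_min.
have : - k * expR (- k * 0) + t * m * expR 0 = 0.
  by rewrite -(@derive_val _ _ _ _ _ _ _ (dg 0)) (@derive_val _ _ _ _ _ _ _ d0).
rewrite mulr0 expR0 !mulr1 => E.
by apply: (mulfI (lt0r_neq0 t0)); rewrite mulrCA mulfV ?gt_eqF//; lra.
Qed.

(** The means [mX] and [mY] satisfy [h mX + h^2 mY <= 0] for all [h], small ones of
    both signs in particular. *)
Lemma centered_mean X Y : measurable_fun setT X -> measurable_fun setT Y ->
  P.-integrable D (EFin \o X) -> P.-integrable D (EFin \o Y) ->
  (forall h : R, \int[P]_(x in D) (expR (h * X x + h ^+ 2 * Y x))%:E = 1)%E ->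
  \int[P]_(x in D) X x = 0.
Proof.
move=> mX mY iX iY lap.
have ineq h : h * \int[P]_(x in D) X x + h ^+ 2 * \int[P]_(x in D) Y x <= 0.
  have ihX := integrableZl mD h iX; have ihY := integrableZl mD (h ^+ 2) iY.
  have {}ihX : P.-integrable D (EFin \o (fun x => h * X x)).
    by apply: eq_integrable ihX => // x _; rewrite EFinM.
  have {}ihY : P.-integrable D (EFin \o (fun x => h ^+ 2 * Y x)).
    by apply: eq_integrable ihY => // x _; rewrite EFinM.
  rewrite -!RintegralZl// -RintegralD//.
  rewrite -(lerD2l 1) addr0; apply: Rintegral_expR_ge (lap h).
    by apply: measurable_funD; exact: measurable_funM.
  by have := integrableD mD ihX ihY; apply: eq_integrable => // x _; rewrite EFinD.
set m := \int[P]_(x in D) X x in ineq *; set q := \int[P]_(x in D) Y x in ineq.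
apply/eqP; apply: contraT => m0.
(* any h with the sign of m that is small compared with m / q would do *)
pose h := m / (1 + q ^+ 2 + q ^+ 2).
have c0 : 0 < 1 + q ^+ 2 + q ^+ 2.
  by rewrite -addrA ltr_pwDl// addr_ge0 ?sqr_ge0.
have := ineq h; rewrite /h.
have -> : m / (1 + q ^+ 2 + q ^+ 2) * m + (m / (1 + q ^+ 2 + q ^+ 2)) ^+ 2 * q =
    m ^+ 2 * (1 + q ^+ 2 + q ^+ 2 + q) / (1 + q ^+ 2 + q ^+ 2) ^+ 2.
  by field; rewrite gt_eqF.
rewrite leNgt divr_gt0// ?exprn_gt0// mulr_gt0 ?exprn_even_gt0//.
by nra.
Qed.

End exponential_moments.

(** * Laplace transform and mean of the Wishart law *)

Lemma powR_div (R : realType) (u t k : R) : 0 < u -> 0 < t ->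
  (u / t) `^ k = u `^ k / t `^ k.
Proof.
by move=> u0 t0; rewrite !powR_expR ?divr_gt0// ln_div ?posrE// mulrBr expRB.
Qed.

Section wishart_path_law.
Context {R : realType}.
Variables (N M : nat) (s : nat -> R).
Hypotheses (MN : (M <= N)%N) (N0 : (0 < N)%N) (s0 : s 0%N = 0) (sN : s N.+2 = 0)
  (sM : 0 < s M.+1)
  (s_neq : forall i, (1 <= i <= N.+1)%N -> i <> M.+1 -> 1 / 2 < s i).
Implicit Types (r : R) (e b : nat -> R).
Local Notation lebIG := (@lebesgue_IG R N.+1).
Local Notation IGR := (@IG R N.+1).

Definition wishart_density r e b (eta : IGR) : R :=
  chain_density N M (s M.+1) (edge_shape s M) r e b (coord1 eta) (coord2 eta).

Definition chain_form_at r e b (eta : IGR) : R :=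
  chain_form N M r e b (coord1 eta) (coord2 eta).

(** Total mass of the weight up to a factor that does not depend on the
    parameters. *)
Definition wishart_norm r e : R :=
  r `^ (- s M.+1) * \prod_(0 <= j < N) e j `^ (- edge_shape s M j).

Lemma edge_shape_gt j : (j < N)%N -> 1 / 2 < edge_shape s M j.
Proof.
by move=> jN; apply: s_neq; clear -jN; rewrite /edge_child; case: ifPn; lia.
Qed.

Lemma wishart_density_ge0 r e b eta : 0 <= wishart_density r e b eta.
Proof. exact: chain_density_ge0. Qed.

Lemma measurable_wishart_density r e b : measurable_fun setT (wishart_density r e b).
Proof.
by apply: measurable_chain_density => i;
  [exact: measurable_coord1|exact: measurable_coord2].
Qed.

Lemma measurable_edge_form (f g h : IGR -> R) (c : R) :
  measurable_fun setT f -> measurable_fun setT g -> measurable_fun setT h ->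
  measurable_fun setT (fun eta => edge_form c (f eta) (g eta) (h eta)).
Proof.
move=> mf mg mh; apply: measurable_funD; last exact: measurable_funM.
by apply: measurable_funD => //; exact: measurable_funM.
Qed.

Lemma measurable_chain_form_at r e b : measurable_fun setT (chain_form_at r e b).
Proof.
apply: measurable_funD.
  by apply: measurable_funM => //; exact: measurable_coord1.
apply: measurable_sum => j; apply: measurable_funM => //.
by apply: measurable_edge_form; [exact: measurable_coord1|exact: measurable_coord2|
  exact: measurable_coord1].
Qed.

Lemma wishart_norm_gt0 r e : 0 < r -> (forall j, 0 < e j) -> 0 < wishart_norm r e.
Proof.
move=> r0 e0; rewrite mulr_gt0 ?powR_gt0// prodr_gt0// => j _.
by rewrite powR_gt0.
Qed.

Lemma integral_wishart_density : exists2 C : R, 0 < C & forall r e b,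
  0 < r -> (forall j, 0 < e j) ->
  (\int[lebIG]_eta (wishart_density r e b eta)%:E = (C * wishart_norm r e)%:E)%E.
Proof.
(* the shapes of the N edges, padded by 1, which exceeds 1 / 2 *)
pose sh j := if (j < N)%N then edge_shape s M j else 1.
have sh2 j : 1 / 2 < sh j.
  by rewrite /sh; case: ifPn => [/edge_shape_gt//|_]; lra.
have [C C0 CE] := integral_chain_density MN sM sh2.
exists C; [exact: C0|move=> r e b r0 e0].
have -> : wishart_norm r e = r `^ (- s M.+1) * \prod_(0 <= j < N) e j `^ (- sh j).
  by congr (_ * _); apply: eq_big_nat => j /andP[_ jN]; rewrite /sh jN.
rewrite -(CE r e b r0 e0) fubini_tonelli1 /fubini_F; first last.
- by move=> eta; rewrite lee_fin wishart_density_ge0.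
- by apply/measurable_EFinP; exact: measurable_wishart_density.
apply: eq_integral => t _; apply: eq_integral => u _; congr EFin.
congr (_ * _); apply: eq_big_nat => j /andP[_ jN].
by rewrite /sh jN.
Qed.

Lemma integral_wishart_weight (y : 'M[R]_N.+1) r e b (c : R) (A : set IGR) :
  represents y (chain_form N M r e b) ->
  (\int[lebIG]_(eta in A `&` @QG R N.+1) (c * wishart_weight M.+1 s y eta)%:E =
   \int[lebIG]_(eta in A) (c * wishart_density r e b eta)%:E)%E.
Proof.
move=> rep; rewrite integral_mkcondr; apply: eq_integral => eta _.
rewrite patchE; case: ifPn => [/set_mem Qeta|/negP nQ].
  by rewrite (wishart_weightE MN N0 s0 sN rep Qeta).
rewrite /wishart_density chain_density_QG ?mulr0// => Qeta.
by apply: nQ; rewrite inE.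
Qed.

Lemma is_wishart_exists (y : 'M[R]_N.+1) : PG y -> exists P, is_wishart M.+1 s y P.
Proof.
move=> Py; have [r [e [b [r0 e0 rep]]]] := PG_chain_form MN Py.
have [C C0 CE] := integral_wishart_density.
have n0 := wishart_norm_gt0 r0 e0.
pose c := (C * wishart_norm r e)^-1.
have c0 : 0 <= c by rewrite invr_ge0 mulr_ge0// ltW.
have mg : measurable_fun setT (fun eta => c * wishart_density r e b eta).
  by apply: measurable_funM => //; exact: measurable_wishart_density.
have g0 eta : 0 <= c * wishart_density r e b eta.
  by rewrite mulr_ge0// wishart_density_ge0.
have g1 : (\int[lebIG]_eta (c * wishart_density r e b eta)%:E = 1)%E.
  under eq_integral do rewrite EFinM.
  rewrite ge0_integralZl//.
  - rewrite CE// -EFinM /c mulVf// gt_eqF// mulr_gt0//.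
  - by apply/measurable_EFinP; exact: measurable_wishart_density.
  - by move=> eta _; rewrite lee_fin wishart_density_ge0.
have [P PE] := probability_of_density mg g0 g1.
exists P, c => A mA.
by rewrite (integral_wishart_weight c A rep) PE.
Qed.

Section moments.
Variables (y : 'M[R]_N.+1) (P : probability IGR R) (r : R) (e b : nat -> R).
Hypotheses (PW : is_wishart M.+1 s y P) (r0 : 0 < r) (e0 : forall j, 0 < e j)
  (rep : represents y (chain_form N M r e b)).
Local Notation Q := (@QG R N.+1).

Let mQ : measurable Q. Proof. exact: measurable_QG. Qed.

(** Two densities with the same shapes differ by the exponential of the difference
    of their chain forms. *)
Lemma wishart_laplace r' e' b' : 0 < r' -> (forall j, 0 < e' j) ->
  (\int[P]_(eta in Q) (expR (chain_form_at r e b eta - chain_form_at r' e' b' eta))%:E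
   = (wishart_norm r' e' / wishart_norm r e)%:E)%E.
Proof.
move=> r'0 e'0.
have [C C0 CE] := integral_wishart_density.
have n0 := wishart_norm_gt0 r0 e0.
have [c cP] := PW.
have {}cP A : measurable A ->
    P A = (\int[lebIG]_(eta in A) (c * wishart_density r e b eta)%:E)%E.
  by move=> /cP ->; exact: integral_wishart_weight.
have mg r1 e1 b1 := measurable_wishart_density r1 e1 b1.
have cE : c * (C * wishart_norm r e) = 1.
  have := cP _ measurableT; rewrite probability_setT.
  under eq_integral do rewrite EFinM.
  rewrite integralZl//; last first.
    apply/integrableP; split; first exact/measurable_EFinP.
    under eq_integral do rewrite /= ger0_norm ?wishart_density_ge0//.
    by rewrite CE// ltry.
  by rewrite CE// -EFinM => -[].
have c0 : 0 < c.
  have : 0 < c * (C * wishart_norm r e) by rewrite cE.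
  by rewrite pmulr_lgt0// mulr_gt0.
rewrite (@ge0_integral_density _ _ _ lebIG _ _ _ P cP)//.
- transitivity (\int[lebIG]_eta (c%:E * (wishart_density r' e' b' eta)%:E))%E.
    rewrite integral_mkcond; apply: eq_integral => eta _.
    rewrite patchE; case: ifPn => [_|/negP nQ]; last first.
      rewrite [wishart_density _ _ _ _]chain_density_QG ?mule0// => Qeta.
      by apply: nQ; rewrite inE.
    rewrite -!EFinM; congr EFin; rewrite mulrCA; congr (_ * _).
    rewrite /wishart_density /chain_density /chain_form_at /chain_form.
    rewrite opprD addrACA -!mulrBl -sumrB expRD expR_sum mulrACA -big_split/=.
    congr (_ * _).
      rewrite /root_density mulrCA; congr (_ * _); rewrite mulrCA; congr (_ * _).
      by rewrite -expRD; congr expR; ring.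
    apply: eq_bigr => j _; rewrite /edge_density mulrCA; congr (_ * _).
    rewrite mulrCA; congr (_ * _); rewrite -expRD; congr expR.
    by rewrite /edge_form; ring.
  rewrite ge0_integralZl//.
  - rewrite CE// -EFinM; congr EFin.
    have C1 : C != 0 by rewrite gt_eqF.
    have n1 : wishart_norm r e != 0 by rewrite gt_eqF.
    apply: (mulIf n1); rewrite divfK//.
    transitivity (c * (C * wishart_norm r e) * wishart_norm r' e'); first by ring.
    by rewrite cE mul1r.
  - exact/measurable_EFinP.
  - by move=> eta _; rewrite lee_fin wishart_density_ge0.
  - by rewrite lee_fin ltW.
- exact: measurable_funM.
- by move=> eta; rewrite mulr_ge0 ?wishart_density_ge0// ltW.
- apply/measurable_EFinP; apply: measurableT_comp => //.
  by apply: measurable_funB; exact: measurable_chain_form_at.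
Qed.

Lemma wishart_QG : P Q = 1%E.
Proof.
have := wishart_laplace b r0 e0.
under eq_integral do rewrite subrr expR0.
by rewrite integral_cst// mul1e divff// gt_eqF// wishart_norm_gt0.
Qed.

Let upd e j (u : R) i := if i == j then u else e i.

Let upd_gt0 e1 j u : (forall j, 0 < e1 j) -> 0 < u -> forall i, 0 < upd e1 j u i.
Proof. by move=> e10 u0 i; rewrite /upd; case: ifP. Qed.

Let edge_at j (eta : IGR) c : R := edge_form c (coord1 eta (edge_parent M j))
  (coord2 eta j) (coord1 eta (edge_child M j)).

Let measurable_edge_at j c : measurable_fun setT (edge_at j ^~ c).
Proof.
by apply: measurable_edge_form; [exact: measurable_coord1|exact: measurable_coord2|
  exact: measurable_coord1].
Qed.

Let chain_form_upd j u c eta : (j < N)%N ->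
  chain_form_at r e b eta - chain_form_at r (upd e j u) (upd b j c) eta =
  e j * edge_at j eta (b j) - u * edge_at j eta c.
Proof.
move=> jN; rewrite /chain_form_at /chain_form opprD addrACA subrr add0r -sumrB.
rewrite (@big_nat_only _ _ j)//; first by rewrite /upd eqxx.
by move=> i /negbTE ij; rewrite /upd ij subrr.
Qed.

(** The root parameter varies alone: the chain form moves by a multiple of [a M]. *)
Lemma wishart_root_mean : P.-integrable Q (EFin \o (fun eta => coord1 eta M)) /\
  \int[P]_(eta in Q) coord1 eta M = s M.+1 / r.
Proof.
apply: (gamma_mean mQ wishart_QG) => //.
- exact: measurable_coord1.
- by move=> eta /(QGE _ N0)[a0 _]; rewrite ltW ?a0.
move=> u u0; have := wishart_laplace b u0 e0.
rewrite (_ : wishart_norm u e / wishart_norm r e = (u / r) `^ (- s M.+1)).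
  move=> <-; apply: eq_integral => eta _; congr (expR _)%:E.
  by rewrite /chain_form_at /chain_form opprD addrACA subrr addr0 mulrBl.
rewrite powR_div// /wishart_norm.
have rr : r `^ (- s M.+1) != 0 by rewrite gt_eqF ?powR_gt0.
have pe : \prod_(0 <= j < N) e j `^ (- edge_shape s M j) != 0.
  by rewrite gt_eqF// prodr_gt0// => j _; rewrite powR_gt0.
by field; rewrite ?rr ?pe.
Qed.

(** The parameter [e j] varies alone: the chain form moves by a multiple of the form
    of the edge. *)
Lemma wishart_edge_mean j : (j < N)%N ->
  P.-integrable Q (EFin \o (fun eta => edge_at j eta (b j))) /\
  \int[P]_(eta in Q) edge_at j eta (b j) = edge_shape s M j / e j.
Proof.
move=> jN; apply: (gamma_mean mQ wishart_QG) => //.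
  move=> eta /(QGE _ N0) cone; have [? ?] := chain_cone_edge M cone jN.
  exact: edge_form_ge0.
move=> u u0; have := wishart_laplace (upd b j (b j)) r0 (upd_gt0 j e0 u0).
rewrite (_ : wishart_norm r (upd e j u) / wishart_norm r e =
   (u / e j) `^ (- edge_shape s M j)).
  move=> <-; apply: eq_integral => eta _; congr (expR _)%:E.
  by rewrite chain_form_upd// mulrBl.
rewrite powR_div ?e0// /wishart_norm.
have split_j e1 : \prod_(0 <= i < N) e1 i `^ (- edge_shape s M i) =
    e1 j `^ (- edge_shape s M j) *
    \prod_(0 <= i < N | i != j) e1 i `^ (- edge_shape s M i).
  by rewrite (bigD1_seq j) ?iota_uniq ?mem_index_iota.
rewrite !split_j [X in _ * (_ * X) / _](eq_bigr (fun i => e i `^ (- edge_shape s M i))).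
  rewrite {1}/upd eqxx.
  have rr : e j `^ (- edge_shape s M j) != 0 by rewrite gt_eqF ?powR_gt0.
  have qr : r `^ (- s M.+1) != 0 by rewrite gt_eqF ?powR_gt0.
  have pe : \prod_(0 <= i < N | i != j) e i `^ (- edge_shape s M i) != 0.
    by rewrite gt_eqF// prodr_gt0// => i _; rewrite powR_gt0.
  by field; rewrite ?rr ?pe ?qr.
by move=> i /negbTE ij; rewrite /upd ij.
Qed.

Let integrable_combine X Y Z (c1 c2 : R) : P.-integrable Q (EFin \o X) ->
  P.-integrable Q (EFin \o Y) -> (forall eta, Z eta = c1 * X eta + c2 * Y eta) ->
  P.-integrable Q (EFin \o Z) /\
  \int[P]_(eta in Q) Z eta = c1 * \int[P]_(eta in Q) X eta + c2 * \int[P]_(eta in Q) Y eta.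
Proof.
move=> iX iY ZE.
have iX1 : P.-integrable Q (EFin \o (fun eta => c1 * X eta)).
  by apply: eq_integrable (integrableZl mQ c1 iX) => // eta _; rewrite EFinM.
have iY1 : P.-integrable Q (EFin \o (fun eta => c2 * Y eta)).
  by apply: eq_integrable (integrableZl mQ c2 iY) => // eta _; rewrite EFinM.
split.
  by apply: eq_integrable (integrableD mQ iX1 iY1) => // eta _ /=; rewrite ZE EFinD.
by rewrite -!RintegralZl// -RintegralD//; apply: eq_Rintegral => eta _; exact: ZE.
Qed.

(** Integrability passes from the parent to the edge and to the child, because on
    the cone [x + b a] is bounded by the sum of the form of the edge and of [a].
    The variation of [b j] alone then shows that [x + b a] is centred. *)
Lemma wishart_edge_step j : (j < N)%N ->
  P.-integrable Q (EFin \o (fun eta => coord1 eta (edge_parent M j))) ->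
  [/\ P.-integrable Q (EFin \o (fun eta => coord2 eta j)),
      P.-integrable Q (EFin \o (fun eta => coord1 eta (edge_child M j))),
      \int[P]_(eta in Q) coord2 eta j =
        - b j * \int[P]_(eta in Q) coord1 eta (edge_parent M j) &
      \int[P]_(eta in Q) coord1 eta (edge_child M j) = edge_shape s M j / e j
        + b j ^+ 2 * \int[P]_(eta in Q) coord1 eta (edge_parent M j)].
Proof.
move=> jN ipa; have [iD DE] := wishart_edge_mean jN.
have m1 i := @measurable_coord1 R N i; have m2 i := @measurable_coord2 R N i.
pose X (eta : IGR) := coord2 eta j + b j * coord1 eta (edge_parent M j).
have mX : measurable_fun setT X.
  by apply: measurable_funD => //; exact: measurable_funM.
have iX : P.-integrable Q (EFin \o X).
  have [iS _] := integrable_combine (c1 := 1) (c2 := 1) iD ipa (fun _ => erefl).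
  apply: le_integrable iS => //; first exact/measurable_EFinP/measurable_funTS.
  move=> eta /(QGE _ N0) cone /=; rewrite lee_fin.
  have [a0 d0] := chain_cone_edge M cone jN.
  have := edge_form_ge (b j) a0 d0; rewrite -/(edge_at j eta (b j)) -/(X eta).
  set D := edge_at _ _ _; set a := coord1 _ _ in a0 *; set x := X eta.
  rewrite ler_pdivrMr// !mul1r => xD.
  have D0 : 0 <= D by rewrite -(pmulr_lge0 _ a0); apply: le_trans xD; exact: sqr_ge0.
  have Da0 : 0 <= D + a by apply: addr_ge0 => //; exact: ltW.
  rewrite [leRHS]ger0_norm// -ler_sqr ?nnegrE ?normr_ge0//.
  rewrite real_normK ?num_real//.
  by apply: (le_trans xD); nra.
have X0 : \int[P]_(eta in Q) X eta = 0.
  pose Y (eta : IGR) := - e j * coord1 eta (edge_parent M j).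
  have ej0 : - (2 * e j) != 0 by rewrite oppr_eq0 mulf_neq0 ?pnatr_eq0 ?gt_eqF.
  apply: (mulfI ej0); rewrite mulr0 -RintegralZl//.
  apply: (@centered_mean _ _ _ P Q mQ wishart_QG _ Y).
  - exact: measurable_funM.
  - by apply: measurable_funM => //; exact: measurable_coord1.
  - by apply: eq_integrable (integrableZl mQ (- (2 * e j)) iX) => // eta _; rewrite EFinM.
  - by apply: eq_integrable (integrableZl mQ (- e j) ipa) => // eta _; rewrite EFinM.
  move=> h; have := wishart_laplace (upd b j (b j + h)) r0 (upd_gt0 j e0 (e0 j)).
  rewrite (_ : wishart_norm r (upd e j (e j)) = wishart_norm r e); last first.
    congr (_ * _); apply: eq_bigr => i _; rewrite /upd; case: eqP => [->//|//].
  rewrite divff ?gt_eqF ?wishart_norm_gt0// => <-.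
  apply: eq_integral => eta _; congr (expR _)%:E.
  by rewrite chain_form_upd// /X /Y /edge_at /edge_form; ring.
have [ix xE] := integrable_combine (c1 := 1) (c2 := - b j)
   (Z := fun eta => coord2 eta j) iX ipa ltac:(by move=> eta; rewrite /X; ring).
have xE' : \int[P]_(eta in Q) coord2 eta j =
        - b j * \int[P]_(eta in Q) coord1 eta (edge_parent M j).
  by rewrite xE X0 mulr0 add0r.
have [iD' D'E] := integrable_combine (c1 := 1) (c2 := - 2 * b j)
   (Z := fun eta => edge_at j eta (b j) - 2 * b j * coord2 eta j) iD ix
   ltac:(by move=> eta /=; ring).
have [ic cE] := integrable_combine (c1 := 1) (c2 := - b j ^+ 2)
   (Z := fun eta => coord1 eta (edge_child M j)) iD' ipa
   ltac:(by move=> eta /=; rewrite /edge_at /edge_form; ring).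
split=> //.
by rewrite cE D'E DE xE'; ring.
Qed.

End moments.

End wishart_path_law.

(** * The mean map and its inverse *)

Section mean_map.
Context {R : realType}.
Variables (N M : nat) (s : nat -> R).
Hypotheses (MN : (M <= N)%N) (N0 : (0 < N)%N) (s0 : s 0%N = 0) (sN : s N.+2 = 0)
  (sM : 0 < s M.+1)
  (s_neq : forall i, (1 <= i <= N.+1)%N -> i <> M.+1 -> 1 / 2 < s i).
Implicit Types (r : R) (e b : nat -> R) (m : @IG R N.+1) (y : 'M[R]_N.+1).

(** The moments of the chain: [x j] has conditional mean [- b j * a p] given [a p],
    and [a c] has conditional mean [s c / e j + b j ^+ 2 * a p]. *)
Definition mean_equations r e b m :=
  coord1 m M = s M.+1 / r /\ forall j, (j < N)%N ->
    coord2 m j = - b j * coord1 m (edge_parent M j) /\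
    coord1 m (edge_child M j) =
      edge_shape s M j / e j + b j ^+ 2 * coord1 m (edge_parent M j).

Lemma wishart_mean_equations y r e b : 0 < r -> (forall j, 0 < e j) ->
  represents y (chain_form N M r e b) ->
  mean_equations r e b (wishart_mean M.+1 s y).
Proof.
move=> r0 e0 rep; have Py := chain_form_PG MN r0 e0 rep.
set P := wishart M.+1 s y.
have PW : is_wishart M.+1 s y P.
  exact: (xgetPex _ (is_wishart_exists MN N0 s0 sN sM s_neq Py)).
have c1 i : (i <= N)%N -> coord1 (wishart_mean M.+1 s y) i =
    \int[P]_(eta in @QG R N.+1) coord1 eta i.
  rewrite -ltnS => iN.
  rewrite /coord1 -(tnth_nth 0 _ (Ordinal iN)) tnth_mktuple.
  by apply: eq_Rintegral => eta _; rewrite (tnth_nth 0).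
have c2 j : (j < N)%N -> coord2 (wishart_mean M.+1 s y) j =
    \int[P]_(eta in @QG R N.+1) coord2 eta j.
  move=> jN; rewrite /coord2 -(tnth_nth 0 _ (Ordinal jN)) tnth_mktuple.
  by apply: eq_Rintegral => eta _; rewrite (tnth_nth 0).
have [iM ME] := wishart_root_mean MN N0 s0 sN sM s_neq PW r0 e0 rep.
have step := wishart_edge_step MN N0 s0 sN sM s_neq PW r0 e0 rep.
have int i : (i <= N)%N ->
    P.-integrable (@QG R N.+1) (EFin \o (fun eta => coord1 eta i)).
  apply: (outward_ind (P := fun i => P.-integrable (@QG R N.+1)
    (EFin \o (fun eta => coord1 eta i))) MN iM) => j jN /(step _ jN).
  by case.
split=> [|j jN]; first by rewrite c1.
have paN := leq_edge_parent M jN; have chN := leq_edge_child M jN.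
by rewrite c2// !c1//; have [_ _ -> ->] := step j jN (int _ paN).
Qed.

Lemma mean_equations_pos r e b m : 0 < r -> (forall j, 0 < e j) ->
  mean_equations r e b m -> forall i, (i <= N)%N -> 0 < coord1 m i.
Proof.
move=> r0 e0 [mM mE]; apply: (outward_ind (P := fun i => 0 < coord1 m i) MN).
  by rewrite mM divr_gt0.
move=> j jN pa0; have [_ ->] := mE j jN.
have sh := edge_shape_gt s_neq jN.
have sh0 : 0 < edge_shape s M j by apply: lt_trans sh; rewrite divr_gt0.
by rewrite ltr_pwDl ?divr_gt0// mulr_ge0 ?sqr_ge0// ltW.
Qed.

Lemma mean_equations_det r e b m : 0 < r -> (forall j, 0 < e j) ->
  mean_equations r e b m -> forall j, (j < N)%N ->
  edge_det m j = coord1 m (edge_parent M j) * (edge_shape s M j / e j).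
Proof.
move=> r0 e0 mE j jN; have [c2 c1] := mE.2 j jN.
by rewrite (edge_detE M) c2 c1; ring.
Qed.

Lemma mean_equations_QG r e b m : 0 < r -> (forall j, 0 < e j) ->
  mean_equations r e b m -> QG m.
Proof.
move=> r0 e0 mE; have m0 := mean_equations_pos r0 e0 mE.
apply/(QGE _ N0); split=> // j jN; rewrite -/(edge_det m j).
rewrite (mean_equations_det r0 e0 mE)// mulr_gt0//.
  exact/m0/leq_edge_parent.
rewrite divr_gt0//; apply: lt_trans (edge_shape_gt s_neq jN).
by rewrite divr_gt0.
Qed.

Lemma mean_equations_inj r e b m m' : mean_equations r e b m ->
  mean_equations r e b m' -> m = m'.
Proof.
move=> [mM mE] [mM' mE'].
have E1 i : (i <= N)%N -> coord1 m i = coord1 m' i.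
  apply: (outward_ind (P := fun i => coord1 m i = coord1 m' i) MN) => [|j jN pa]; first by rewrite mM mM'.
  by have [_ ->] := mE j jN; have [_ ->] := mE' j jN; rewrite pa.
have E2 j : (j < N)%N -> coord2 m j = coord2 m' j.
  move=> jN; have [-> _] := mE j jN; have [-> _] := mE' j jN; rewrite E1//.
  exact: leq_edge_parent.
rewrite [m]surjective_pairing [m']surjective_pairing.
by congr (_, _); apply: eq_from_tnth => i; rewrite !(tnth_nth 0);
  [apply: E1; rewrite -ltnS|apply: E2].
Qed.

Definition inverse_mean_formula m : 'M[R]_N.+1 :=
  \sum_(1 <= k < M.+1) s k *: block_inv0 m k k.+1
  + \sum_(M.+2 <= k < N.+2) s k *: block_inv0 m k.-1 k
  - \sum_(2 <= k < M.+1) s k.-1 *: diag_inv0 m k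
  - (s M.+1.-1 - s M.+1 + s M.+2) *: diag_inv0 m M.+1
  - \sum_(M.+2 <= k < N.+1) s k.+1 *: diag_inv0 m k.

Lemma chain_form_eq r e b e' b' a x :
  (forall j, (j < N)%N -> e j = e' j) -> (forall j, (j < N)%N -> b j = b' j) ->
  chain_form N M r e b a x = chain_form N M r e' b' a x.
Proof.
move=> ee bb; congr (_ + _); apply: eq_big_nat => j /andP[_ jN].
by rewrite ee ?bb.
Qed.

(** Solving the mean equations for the parameters gives the parameters of the
    formula. *)
Lemma inverse_mean_formulaE y r e b m : 0 < r -> (forall j, 0 < e j) ->
  represents y (chain_form N M r e b) -> mean_equations r e b m ->
  inverse_mean_formula m = y.
Proof.
move=> r0 e0 rep mE.
have rep' := inverse_mean_represents MN N0 s0 sN (mean_equations_QG r0 e0 mE).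
apply: represents_inj rep' (eq_represents _ rep) => a x.
have m0 := mean_equations_pos r0 e0 mE.
have sh0 j : (j < N)%N -> 0 < edge_shape s M j.
  by move=> jN; apply: lt_trans (edge_shape_gt s_neq jN); rewrite divr_gt0.
have pa0 j : (j < N)%N -> 0 < coord1 m (edge_parent M j).
  by move=> jN; exact/m0/leq_edge_parent.
rewrite mE.1 (_ : s M.+1 / (s M.+1 / r) = r); last first.
  by field; rewrite !gt_eqF.
apply: chain_form_eq => j jN.
  rewrite (mean_equations_det r0 e0 mE)//; field.
  by rewrite !gt_eqF ?pa0 ?sh0.
have [-> _] := mE.2 j jN.
by field; rewrite gt_eqF ?pa0.
Qed.

Lemma mean_equations_solve m : QG m -> exists r e b, [/\ 0 < r,
  (forall j, 0 < e j) & mean_equations r e b m].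
Proof.
move=> /(QGE _ N0) cone; have [m0 d0] := cone.
have mM := m0 M MN.
have sh0 j : (j < N)%N -> 0 < edge_shape s M j.
  by move=> jN; apply: lt_trans (edge_shape_gt s_neq jN); rewrite divr_gt0.
exists (s M.+1 / coord1 m M), (fun j => if (j < N)%N
    then edge_shape s M j * coord1 m (edge_parent M j) / edge_det m j else 1),
  (fun j => - (coord2 m j / coord1 m (edge_parent M j))).
split; first by rewrite divr_gt0.
  move=> j; case: ifPn => // jN; have [pa0 _] := chain_cone_edge M cone jN.
  by rewrite divr_gt0 ?mulr_gt0 ?sh0 ?d0.
split; first by field; rewrite !gt_eqF.
move=> j jN; rewrite jN; have [pa0 _] := chain_cone_edge M cone jN.
have dj : 0 < edge_det m j by exact: d0.
rewrite (edge_detE M) in dj *.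
split; first by field; rewrite gt_eqF.
by field; rewrite !gt_eqF ?sh0.
Qed.

Lemma wishart_mean_formula y : PG y ->
  QG (wishart_mean M.+1 s y) /\ inverse_mean_formula (wishart_mean M.+1 s y) = y.
Proof.
move=> Py; have [r [e [b [r0 e0 rep]]]] := PG_chain_form MN Py.
have mE := wishart_mean_equations r0 e0 rep.
by split; [exact: mean_equations_QG mE|exact: inverse_mean_formulaE rep mE].
Qed.

Lemma wishart_mean_surj m : QG m -> exists2 y, PG y & wishart_mean M.+1 s y = m.
Proof.
move=> /mean_equations_solve[r [e [b [r0 e0 mE]]]].
have [y rep] := @chain_form_represents R N M r e b MN.
exists y; first exact: chain_form_PG rep.
exact: mean_equations_inj (wishart_mean_equations r0 e0 rep) mE.
Qed.

Lemma wishart_mean_bij : set_bij (@PG R N.+1) (@QG R N.+1) (wishart_mean M.+1 s).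
Proof.
split.
- by move=> y /wishart_mean_formula[].
- move=> y y' /set_mem Py /set_mem Py' yy'.
  have [_ <-] := wishart_mean_formula Py; have [_ <-] := wishart_mean_formula Py'.
  by rewrite yy'.
- by move=> m /wishart_mean_surj[y Py ym]; exists y.
Qed.

Lemma wishart_inverse_meanE m : QG m ->
  wishart_inverse_mean M.+1 s m = inverse_mean_formula m.
Proof.
move=> Qm; have [_ _ surj] := wishart_mean_bij.
have mK := surjpK (fun=> 0) surj (mem_set Qm).
have Pm : PG (wishart_inverse_mean M.+1 s m).
  by apply: (surjpinv_image_sub (dflt := fun=> 0) surj); exists m.
by have [_] := wishart_mean_formula Pm; rewrite mK => ->.
Qed.

End mean_map.

Theorem corollary3 (R : realType) (n M : nat) (s : nat -> R)
    (n_ge2 : (2 <= n)%N) (M_range : (1 <= M <= n)%N)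
    (s_neq : forall i : nat, (1 <= i <= n)%N -> i <> M -> 1 / 2 < s i)
    (s_M : 0 < s M) (s_0 : s 0%N = 0) (s_n1 : s n.+1 = 0) :
  set_bij (@PG R n) (@QG R n) (wishart_mean M s) /\
  forall m : IG n, QG m ->
    wishart_inverse_mean M s m =
      \sum_(1 <= k < M) s k *: block_inv0 m k k.+1
      + \sum_(M.+1 <= k < n.+1) s k *: block_inv0 m k.-1 k
      - \sum_(2 <= k < M) s k.-1 *: diag_inv0 m k
      - (s M.-1 - s M + s M.+1) *: diag_inv0 m M
      - \sum_(M.+1 <= k < n) s k.+1 *: diag_inv0 m k.
Proof.
have /andP[M_gt0 M_le] := M_range.
have [N nE] : exists N, n = N.+1 by exists n.-1; rewrite prednK// (leq_trans _ M_le).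
have [M' ME] : exists M', M = M'.+1 by exists M.-1; rewrite prednK.
subst n M; have MN : (M' <= N)%N by []; have N0 : (0 < N)%N by [].
split=> [|m Qm].
  exact: (wishart_mean_bij MN N0 s_0 s_n1 s_M s_neq).
exact: (wishart_inverse_meanE MN N0 s_0 s_n1 s_M s_neq Qm).
Qed.
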